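(* Let $\bm{T}$ be a $\bm{\sigma}$-Galton--Watson tree with type set $\mathfrak{G}$, and let $\kappa\in\mathfrak{G}$, $\gamma\in\mathfrak{G}\setminus\{\kappa\}$. Let $(\mathcal{E}_n)_n$ be events with $\mathbb{P}(\mathcal{E}_n)>0$ for all $n$, and let $\bm{T}_n := (\bm{T}\mid \mathcal{E}_n)$. Suppose that $\mathbb{E}[\#_\kappa\bm{T}^\kappa]=2$ and that there is a deterministic sequence $s_n\to\infty$ such that for all $\epsilon>0$ $$\exp(-\epsilon s_n)=o(\mathbb{P}(\mathcal{E}_n))\qquad\text{and}\qquad \mathbb{P}(\#_\kappa\bm{T}_n\ge s_n)\to 1 .$$ Furthermore, assume that $0<\mathbb{E}[\#_\gamma\bm{T}^\kappa]<\infty$. Then for any finite $\mathfrak{G}$-type plane tree $T$ with root type $\kappa$ and any type $\gamma$ vertex $v$ of $T$, $$\frac{N_{(T,v)}(\bm{T}_n)}{\mathbb{E}[\#_\gamma\bm{T}^\kappa]\,\#_\kappa\bm{T}_n}\xrightarrow{\;p\;}\mathbb{P}\big(f^{\kappa,[h]}(\hat{\bm{T}}(\kappa,\gamma))=(T,v)\big),$$ with $h+1$ denoting the number of vertices of type $\kappa$ on the path from the root to $v$ in $T$. Let $v_n^\gamma$ denote a uniformly selected type $\gamma$ vertex of $\bm{T}_n$. If $$\frac{\#_\gamma\bm{T}_n}{\#_\kappa\bm{T}_n}\xrightarrow{\;p\;}\mathbb{E}[\#_\gamma\bm{T}^\kappa],$$ then $$\mathfrak{L}((\bm{T}_n,v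_n^\gamma)\mid\bm{T}_n)\xrightarrow{\;p\;}\mathfrak{L}(\hat{\bm{T}}(\kappa,\gamma)).$$
   Context: All limits are as $n\to\infty$; $\xrightarrow{p}$ is convergence in probability; $\mathfrak{L}$ denotes (conditional) laws. Types and trees. $\mathfrak{G}$ is a countable non-empty set of types. A $\mathfrak{G}$-type plane tree is a rooted ordered tree, each vertex having finitely many children, with a type in $\mathfrak{G}$ assigned to each vertex. $\#_iT$ is the number of vertices of type $i$ in $T$. The fringe subtree at a vertex is the tree formed by that vertex and all its descendants. Branching trees. $\bm{\sigma}=(\bm{\sigma}_i)_{i\in\mathfrak{G}}$ is an independent family of random finite words over $\mathfrak{G}$. The $\bm{\sigma}$-Galton--Watson tree $\bm{T}$ has root type given by an independent random type $\alpha$, and each vertex of type $i$ independently receives an ordered list of children with types given by an independent copy of $\bm{\sigma}_i$. Standing assumptions: $\mathbb{P}(\#_i\bm{T}\ne0)>0$ for all $i\in\mathfrak{G}$, and $\bm{T}$ is almost surely finite. $\bm{T}(\kappa)$ is the same tree started with a root of type $\kappa$. $\bm{T}^\kappa$ is defined like $\bm{T}(\kappa)$, except that non-root vertices of type $\kappa$ receive no offspring. The limit tree. When $\mathbb{E}[\#_\kappa\bm{T}^\kappa]=2$, $\hat{\bm{T}}^\kappa$ is the random marked tree with $\mathbb{P}(\hat{\bm{T}}^\kappa=(T,u))=\mathbb{P}(\bm{T}^\kappa=T)$ for every $\mathfrak{G}$-type tree $T$ (root of type $\kappa$, non-root type $\kappa$ vertices without offspring) and every non-root vertex $u$ of $T$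 of type $\kappa$. $\hat{\bm{T}}^{\kappa,\gamma}$ is the random marked tree with $\mathbb{P}(\hat{\bm{T}}^{\kappa,\gamma}=(T,u))=\mathbb{P}(\bm{T}^\kappa=T)/\mathbb{E}[\#_\gamma\bm{T}^\kappa]$ for every such finite $T$ and every vertex $u$ of $T$ of type $\gamma$. The infinite tree $\hat{\bm{T}}(\kappa,\gamma)$ is built as follows: there are vertices $u_0,u_1,\ldots$ of type $\kappa$; $u_0$ is the root of an independent copy of $\hat{\bm{T}}^{\kappa,\gamma}$, whose marked vertex is the marked vertex of $\hat{\bm{T}}(\kappa,\gamma)$ and whose non-root type $\kappa$ vertices all become roots of independent copies of $\bm{T}(\kappa)$; for each $i\ge1$, $u_i$ is the root of an independent copy of $\hat{\bm{T}}^\kappa$, whose marked vertex is identified with $u_{i-1}$ and whose non-marked, non-root type $\kappa$ vertices become roots of independent copies of $\bm{T}(\kappa)$. Marked trees. For a marked tree $(T_1,v_1)$, $f^{\kappa,[h]}(T_1,v_1)$ is the fringe subtree at that ancestor $w$ of $v_1$ (possibly $v_1$ itself) which has type $\kappa$ and for which the path from $w$ to $v_1$ contains precisely $h+1$ vertices of type $\kappa$ (endpoints included), marked at $v_1$; if no such $w$ exists it returns $(T_1,v_1)$ together with an overflow flag. For $(T,v)$ with $h+1$ type $\kappa$ vertices on the path from the root to $v$, $N_{(T,v)}(T_1)$ is the number of vertices $u$ of $T_1$ with $f^{\kappa,[h]}(T_1,u)=(T,v)$ without overflow. Similarly $f^{[h]}(T_1,v_1)$ is the fringe subtree at the $h$-th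 ancestor of $v_1$ (the $0$-th being $v_1$), marked at $v_1$; if that ancestor does not exist it is $(T_1,v_1)$ with an overflow flag. Space and convergence. $\mathfrak{X}$ is the set of all finite marked $\mathfrak{G}$-type plane trees together with all locally finite $\mathfrak{G}$-type plane trees having a marked vertex with a countably infinite number of ancestors (hence no root) and all $f^{[h]}$ finite. Its metric is $d(T_1^\bullet,T_2^\bullet)=2$ if $f^{[0]}(T_1^\bullet)\neq f^{[0]}(T_2^\bullet)$, and $2^{-\sup\{h\ge0:\,f^{[h]}(T_1^\bullet)=f^{[h]}(T_2^\bullet)\}}$ otherwise ($2^{-\infty}=0$). The conditional law $\mathfrak{L}((\bm{T}_n,v_n^\gamma)\mid\bm{T}_n)$ is the random Borel probability measure on $\mathfrak{X}$ which is uniform on the pairs $(\bm{T}_n,v)$, $v$ a type $\gamma$ vertex of $\bm{T}_n$ (arbitrary if there is none); convergence in probability is with respect to the topology of weak convergence of probability measures on $\mathfrak{X}$. *)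

(* Defs.v *)
From HB Require Import structures.
From mathcomp Require Import all_boot all_order all_algebra.
From mathcomp Require Import finmap.
From mathcomp Require Import all_classical all_reals all_analysis.

Set Implicit Arguments.
Unset Strict Implicit.
Unset Printing Implicit Defensive.

Import Order.TTheory GRing.Theory Num.Theory.
Import numFieldTopology.Exports numFieldNormedType.Exports.

Local Open Scope classical_set_scope.
Local Open Scope ring_scope.

Inductive tree (G : Type) : Type := Node of G & seq (tree G).

Section TreeCount.
Variable G : countType.

Fixpoint tree_encode (t : tree G) : GenTree.tree G :=
  let: Node i ts := t in GenTree.Node 0 (GenTree.Leaf i :: map tree_encode ts).

Fixpoint tree_decode (t : GenTree.tree G) : option (tree G) :=
  if t is GenTree.Node _ (GenTree.Leaf i :: ts)
  then Some (Node i (pmap tree_decode ts)) else None.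

Lemma tree_encodeK : pcancel tree_encode tree_decode.
Proof.
rewrite /pcancel; fix IH 1 => -[i ts] /=; congr (Some (Node i _)).
by elim: ts => [//|t ts IHts] /=; rewrite IH /= IHts.
Qed.

HB.instance Definition _ := Countable.copy (tree G) (pcan_type tree_encodeK).
End TreeCount.

Section Trees.
Variable G : countType.
Implicit Types (t s : tree G) (u v w : seq nat) (i kappa : G) (h : nat).

Definition ttype t : G := let: Node i _ := t in i.
Definition children t : seq (tree G) := let: Node _ ts := t in ts.

(* Vertices are Ulam-Harris addresses: [subtree t u] is the fringe subtree of
   [t] at [u], and [None] if [u] is not a vertex of [t]. *)
Fixpoint subtree t u : option (tree G) :=
  if u is k :: u' then
    if onth (children t) k is Some s then subtree s u' else None
  else Some t.

Definition vtype t u : option G := omap ttype (subtree t u).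

Fixpoint vertices t : seq (seq nat) :=
  let: Node _ ts := t in
  [::] :: (fix below (k : nat) (ts : seq (tree G)) {struct ts} :=
    if ts is s :: ts' then map (cons k) (vertices s) ++ below k.+1 ts'
    else [::]) 0%N ts.

Definition nb_type i t : nat := count (fun u => vtype t u == Some i) (vertices t).

(* Going down from the root, the fringe subtree at [u] is replaced by [s]
   as soon as [g u = Some s]. *)
Fixpoint graft (g : seq nat -> option (tree G)) t {struct t} : tree G :=
  if g [::] is Some s then s else
  let: Node i ts := t in
  Node i ((fix below (k : nat) (ts : seq (tree G)) {struct ts} :=
    if ts is s :: ts' then graft (fun u => g (k :: u)) s :: below k.+1 ts'
    else [::]) 0%N ts).

Lemma subtree_cat t u w :
  subtree t (u ++ w) = obind (fun s => subtree s w) (subtree t u).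
Proof. by elim: u t => [//|k u IH] t /=; case: onth => //= s; exact: IH. Qed.

Lemma tree_nested_ind (Q : tree G -> Prop) :
  (forall i ts, (forall s, s \in ts -> Q s) -> Q (Node i ts)) -> forall t, Q t.
Proof.
move=> HQ; fix IH 1 => -[i ts]; apply: HQ.
elim: ts => [s|s ts IHts s']; first by clear IH.
by rewrite inE => /orP[/eqP->|]; [exact: IH | exact: IHts].
Qed.

Lemma mem_vertices t u : (u \in vertices t) = (subtree t u : bool).
Proof.
elim/tree_nested_ind: t u => i ts IH [|k u] /=; first by rewrite inE.
rewrite inE /=; set below := (X in _ \in X 0%N ts).
suff H n : ((n + k)%N :: u \in below n ts) =
    isSome (if onth ts k is Some s then subtree s u else None).
  by rewrite -(H 0%N).
have lt_below m j w l : (m < j)%N -> (m :: w \in below j l) = false.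
  elim: l j => [//|s l IHl] j mj /=; rewrite mem_cat IHl ?(ltn_trans mj)// orbF.
  by apply/negP => /mapP[w' _ [E]]; rewrite E ltnn in mj.
elim: ts n k IH => [|s l IHl] n [|k] IH //=; rewrite mem_cat.
  rewrite addn0 lt_below// orbF mem_map ?IH ?inE ?eqxx// => ? ? [] //.
rewrite addnS -addSn IHl => [|s' s'l]; last first.
  by apply: IH; rewrite inE s'l orbT.
case: mapP => // -[w _ [/eqP]].
by rewrite addSn -addnS -[X in _ == X]addn0 eqn_add2l.
Qed.

Definition mtree := {p : tree G * seq nat | subtree p.1 p.2 : bool}.
Implicit Type p : mtree.

Definition mroot_type p : G := ttype (val p).1.
Definition mark_type p : option G := vtype (val p).1 (val p).2.

Definition markings t : seq mtree := pmap insub [seq (t, u) | u <- vertices t].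

(* number of vertices of type [kappa] on the path from the root to the mark *)
Definition kpath kappa p : nat :=
  count (fun k => vtype (val p).1 (take k (val p).2) == Some kappa)
        (iota 0 (size (val p).2).+1).

(* $f^{[h]}$; the boolean is the overflow flag *)
Definition fringe h p : mtree * bool :=
  let t := (val p).1 in let v := (val p).2 in
  if (h <= size v)%N then
    (insubd p (odflt t (subtree t (take (size v - h) v)),
               drop (size v - h) v), false)
  else (p, true).

(* the default value [p] of [insubd p] is never used in [fringe] *)
Lemma fringe_val h p : (h <= size (val p).2)%N ->
  Some (val (fringe h p).1).1 =
    subtree (val p).1 (take (size (val p).2 - h) (val p).2) /\
  (val (fringe h p).1).2 = drop (size (val p).2 - h) (val p).2.
Proof.
move=> hp; rewrite /fringe hp; case: p hp => -[t v] /= tv hp.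
have := tv; rewrite -{1}(cat_take_drop (size v - h) v) subtree_cat.
case E : (subtree t (take _ v)) => [s|//] /= sv.
by rewrite val_insubd /= sv.
Qed.

(* A tree without root is the increasing union of its fringe subtrees
   $f^{[h]}$, $h \ge 0$, and is represented by this sequence of finite marked
   trees. *)
Definition itree := {f : nat -> mtree |
  forall h, size (val (f h)).2 = h /\ fringe h (f h.+1) = (f h, false)}.

Inductive ptree := Fin of mtree | Inf of itree.
Implicit Type x : ptree.

Definition pfringe h x : mtree * bool :=
  match x with Fin p => fringe h p | Inf f => (sval f h, false) end.

(* The candidate with [m] edges from its root to the mark is $f^{\kappa,[h]}$:
   the [m]-th ancestor of the mark exists, has type [kappa], and there are
   [h.+1] vertices of type [kappa] from it to the mark. At most one [m] has
   this property. *)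
Definition kfringe_at kappa h x (m : nat) : bool :=
  let q := pfringe m x in
  [&& ~~ q.2, mroot_type q.1 == kappa & kpath kappa q.1 == h.+1].

(* $f^{\kappa,[h]}$; the boolean is the overflow flag *)
Definition kfringe kappa h x : ptree * bool :=
  if pselect (exists m, kfringe_at kappa h x m) is left ex
  then (Fin (pfringe (ex_minn ex) x).1, false) else (x, true).

(* $N_{(T,v)}(t)$ for $p = (T,v)$ with [h.+1] vertices of type [kappa] on the
   path from the root to the mark *)
Definition Noccur kappa h p t : nat :=
  count (fun q => `[< kfringe kappa h (Fin q) = (Fin p, false) >]) (markings t).

Lemma fringe_size h p : (h <= size (val p).2)%N -> size (val (fringe h p).1).2 = h.
Proof. by move=> hp; rewrite (fringe_val hp).2 size_drop subKn. Qed.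

Lemma fringe_comp h k p : (h <= k)%N -> fringe h (fringe k p).1 = fringe h p.
Proof.
move=> hk; have [kp|kp] := leqP k (size (val p).2); last first.
  by rewrite {2}/fringe leqNgt kp.
have hp := leq_trans hk kp; have [e1 e2] := fringe_val kp.
have hq : (h <= size (val (fringe k p).1).2)%N by rewrite fringe_size.
have [a1 a2] := fringe_val hq; have [b1 b2] := fringe_val hp.
suff E : val (fringe h (fringe k p).1).1 = val (fringe h p).1.
  rewrite [LHS]surjective_pairing [RHS]surjective_pairing (val_inj E).
  by congr pair; move: hp hq; rewrite /fringe => -> ->.
rewrite [LHS]surjective_pairing [RHS]surjective_pairing; congr pair.
  apply: Some_inj; rewrite a1 b1 fringe_size//.
  have -> : take (size (val p).2 - h) (val p).2 =
      take (size (val p).2 - k) (val p).2 ++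
      take (k - h) (val (fringe k p).1).2.
    rewrite e2 take_drop addnC addnBA// subnK//.
    rewrite -{1}(cat_take_drop (size (val p).2 - k) (take _ _)).
    by rewrite take_takel ?leq_sub2l.
  by rewrite subtree_cat -e1.
by rewrite a2 b2 fringe_size// e2 drop_drop addnC addnBA// subnK.
Qed.

Lemma pfringe_comp h k x : (h <= k)%N -> fringe h (pfringe k x).1 = pfringe h x.
Proof.
case: x => [p|[f Hf]] hk /=; first exact: fringe_comp.
have self j : fringe j (f j) = (f j, false).
  by have := fringe_comp (f j.+1) (leqnn j); rewrite (Hf j).2.
elim: k hk => [|k IH] hk; first by move: hk; rewrite leqn0 => /eqP ->.
move: hk; rewrite leq_eqVlt => /orP[/eqP->|hk]; first exact: self.
by rewrite -IH// -(fringe_comp (f k.+1) (_ : h <= k)%N)// (Hf k).2.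
Qed.

Lemma pfringe_down h k x y :
  (h <= k)%N -> pfringe k x = pfringe k y -> pfringe h x = pfringe h y.
Proof. by move=> hk e; rewrite -!(pfringe_comp _ hk) e. Qed.

Lemma pfringe_inj x y : (forall h, pfringe h x = pfringe h y) -> x = y.
Proof.
case: x => [p|f]; case: y => [q|g] H.
- have := H (maxn (size (val p).2) (size (val q).2)).+1.
  by rewrite /= /fringe !ifN -?ltnNge ?ltnS ?leq_maxl ?leq_maxr// => -[->].
- by have := H (size (val p).2).+1; rewrite /= /fringe ltnn.
- by have := H (size (val q).2).+1; rewrite /= /fringe ltnn.
- case: f g H => [f Hf] [g Hg] H; have fg : f = g.
    by apply/funext => h; have [] := H h.
  by subst g; congr (Inf (exist _ _ _)); exact: Prop_irrelevance.
Qed.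
End Trees.

Arguments Fin {G}.
Arguments Inf {G}.

Section PtreeMetric.
Variables (R : realType) (G : countType).
Local Notation X := (ptree G).

(* $2^{-s}$ for $s \in [0, +\infty]$ *)
Definition pow2N (s : \bar R) : R := if s is r%:E then 2 `^ (- r) else 0.

Definition pdist (x y : X) : R :=
  if pfringe 0 x == pfringe 0 y then
    pow2N (ereal_sup [set h%:R%:E | h in [set h | pfringe h x = pfringe h y]])
  else 2.

Let agree (x y : X) := [set h | pfringe h x = pfringe h y].
Let top (x y : X) : \bar R := ereal_sup [set h%:R%:E | h in agree x y].

Let top_ge0 x y : pfringe 0 x = pfringe 0 y -> (0 <= top x y)%E.
Proof. by move=> e; apply: ereal_sup_ubound; exists 0%N. Qed.

Let pow2N_ge0 s : 0 <= pow2N s.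
Proof. by case: s => //= r; exact: powR_ge0. Qed.

Let pow2N_anti s s' : (0 <= s)%E -> (s <= s')%E -> pow2N s' <= pow2N s.
Proof.
case: s s' => [r| |] [r'| |] // _ rr'.
by rewrite /= ler_powR ?ler1n// lerN2 -lee_fin.
Qed.

Let pdist_le2 x y : pdist x y <= 2.
Proof.
rewrite /pdist; case: ifPn => // /eqP /top_ge0 /(pow2N_anti (lexx 0%E)).
by move=> /le_trans; apply; rewrite /= oppr0 powRr0 ler1n.
Qed.

Lemma pdistxx x : pdist x x = 0.
Proof.
rewrite /pdist eqxx; suff : top x x = +oo%E by rewrite /top /agree => ->.
apply/eqyP => r r0; apply: (@le_trans _ _ (Num.truncn r).+1%:R%:E).
  by rewrite lee_fin ltW// truncnS_gt.
by apply: ereal_sup_ubound; exists (Num.truncn r).+1.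
Qed.

Lemma pdist_sym x y : pdist x y = pdist y x.
Proof.
rewrite /pdist eq_sym; congr (if _ then pow2N (ereal_sup (_ @` _)) else _).
by apply/seteqP; split => h /= ->.
Qed.

Lemma pdist_positivity x y : pdist x y = 0 -> x = y.
Proof.
rewrite /pdist; case: ifPn => [/eqP e0|_ /eqP]; last by rewrite pnatr_eq0.
have := top_ge0 e0; rewrite /top -/(agree x y); set s := ereal_sup _.
case E : s => [r| |] //= _; first by move=> /eqP; rewrite powR_eq0 pnatr_eq0.
move=> _; apply: pfringe_inj => h.
have : (h%:R%:E < s)%E by rewrite E ltry.
move=> /ereal_sup_gt[_ [k hk <-]]; rewrite lte_fin ltr_nat => /ltnW.
by move=> /pfringe_down; apply.
Qed.

Lemma pdist_triangle y x z : pdist x z <= pdist x y + pdist y z.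
Proof.
have ge0 a b : 0 <= pdist a b by rewrite /pdist; case: ifP.
suff: pdist x z <= pdist x y \/ pdist x z <= pdist y z.
  by move=> [] /le_trans; apply; rewrite ?lerDl ?lerDr.
have [e1|n1] := eqVneq (pfringe 0 x) (pfringe 0 y); last first.
  by left; rewrite {2}/pdist (negbTE n1) pdist_le2.
have [e2|n2] := eqVneq (pfringe 0 y) (pfringe 0 z); last first.
  by right; rewrite {2}/pdist (negbTE n2) pdist_le2.
have e3 := etrans e1 e2.
rewrite /pdist e1 e2 !eqxx -/(top x z) -/(top x y) -/(top y z).
have [sub|] := pselect (agree x y `<=` agree x z).
  by left; apply: pow2N_anti; [exact: top_ge0|apply/ereal_sup_le/image_subset].
move=> /existsNP[k /not_implyP[kxy nkxz]].
right; apply: pow2N_anti; first exact: top_ge0.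
apply/ereal_sup_le/image_subset => h hyz.
have [hk|kh] := leqP h k.
  by rewrite /agree/= (pfringe_down hk kxy).
by exfalso; apply: nkxz; rewrite /agree/= kxy (pfringe_down (ltnW kh) hyz).
Qed.
End PtreeMetric.

(* [ptree G] with the distance [pdist]. The type is nonempty because [G]
   contains [g0]; this is needed only because measurable spaces are pointed
   types in the library. *)
Definition mspace (R : realType) (G : countType) (g0 : G) : Type := ptree G.

Section Mspace.
Variables (R : realType) (G : countType) (g0 : G).
Local Notation X := (mspace R g0).

HB.instance Definition _ := gen_eqMixin X.
HB.instance Definition _ := gen_choiceMixin X.

Definition root_marking : mtree G := exist _ (Node g0 [::], [::]) isT.

HB.instance Definition _ := isPointed.Build X (Fin root_marking).
HB.instance Definition _ := @isMetric.Build R X (@pdist R G)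
  (@pdistxx R G) (@pdist_positivity R G) (@pdist_sym R G) (@pdist_triangle R G).
End Mspace.

Definition borel_space (R : realType) (G : countType) (g0 : G) :=
  g_sigma_algebraType (@open (mspace R g0)).

Section Weak.
Variables (R : realType) (X : ptopologicalType).
Local Notation B := (g_sigma_algebraType (@open X)).

Definition bounded_continuous :=
  {f : X -> R | continuous f /\ exists M : R, forall x, `|f x| <= M}.

Definition integrate (mu : probability B R) : {ptws bounded_continuous -> R} :=
  fun f => Rintegral mu setT (sval f).

Definition weak_probability : Type := initial_topology integrate.
HB.instance Definition _ := Topological.on weak_probability.
End Weak.

Section Probability.
Context {R : realType} {d : measure_display} {W : measurableType d}.
Variable P : probability W R.

(* A random variable with values in a countable set [S], carrying the discrete
   $\sigma$-algebra. *)
Definition discrete_rv (S : countType) (X : W -> S) : Prop :=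
  forall A : set S, measurable (X @^-1` A).

Definition mutually_independent (I : choiceType) (S : I -> countType)
    (X : forall i, W -> S i) : Prop :=
  forall (J : {fset I}) (A : forall i, set (S i)),
    fine (P (\bigcap_(i in [set` J]) X i @^-1` A i)) =
    \prod_(i <- J) fine (P (X i @^-1` A i)).

Definition same_law (S : countType) (X Y : W -> S) : Prop :=
  forall x, P (X @^-1` [set x]) = P (Y @^-1` [set x]).

(* $\mathbb{P}(A \mid E)$ *)
Definition cond_prob (E A : set W) : R := fine (P (A `&` E)) / fine (P E).

(* $X_n \to c$ in probability, for $X_n$ distributed like [X] conditioned on
   the event [E n] *)
Definition cvg_in_cond_prob (E : nat -> set W) (X : W -> R) (c : R) : Prop :=
  forall eps : R, 0 < eps ->
    (fun n => cond_prob (E n) [set w | eps < `|X w - c|]) @ \oo --> (0 : R).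

Definition cvg_in_cond_prob_top (Y : topologicalType) (E : nat -> set W)
    (X : W -> Y) (c : Y) : Prop :=
  forall U : set Y, nbhs c U ->
    (fun n => cond_prob (E n) (X @^-1` U)) @ \oo --> (1 : R).
End Probability.

Section GaltonWatson.
Context {R : realType} {G : countType} {d : measure_display}
  {W : measurableType d}.
Variable P : probability W R.
Implicit Types (alpha : W -> G) (sigma : G -> W -> seq G)
  (xi : seq nat * G -> W -> seq G) (T : W -> tree G).

(* the random root type together with the copies of the offspring words:
   [xi (u, i)] is the word used at the vertex [u] if it has type [i] *)
Definition source_type (k : option (seq nat * G)) : countType :=
  if k is Some _ then seq G else G.
Definition source alpha xi (k : option (seq nat * G)) : W -> source_type k :=
  match k with Some ui => xi ui | None => alpha end.

Definition offspring_family sigma alpha xi : Prop :=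
  [/\ forall i, discrete_rv (sigma i),
      mutually_independent P sigma,
      discrete_rv alpha /\ (forall ui, discrete_rv (xi ui)),
      mutually_independent P (source alpha xi) &
      forall u i, same_law P (xi (u, i)) (sigma i)].

(* [T] is the tree with root type [alpha] where the vertex [u], if it has type
   [i], receives children with types [xi (u, i)]. That this tree is almost
   surely finite is part of the definition, [T] being valued in finite trees. *)
Definition galton_watson alpha xi T : Prop :=
  discrete_rv T /\
  {ae P, forall w, ttype (T w) = alpha w /\
    forall u s, subtree (T w) u = Some s ->
      [seq ttype c | c <- children s] = xi (u, ttype s) w}.

(* the offspring of $\bm{T}^\kappa$: none at non-root vertices of type [kappa] *)
Definition stopped (kappa : G) xi (ui : seq nat * G) : W -> seq G :=
  if (ui.1 != [::]) && (ui.2 == kappa) then cst [::] else xi ui.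

Definition mean_nb (i : G) T : \bar R := 'E_P[fun w => (nb_type i (T w))%:R].

Definition tree_prob T (t : tree G) : \bar R := P (T @^-1` [set t]).
End GaltonWatson.

Section LimitTree.
Variables (G : countType) (kappa : G).

(* The tree of [p] where every non-root vertex [u] of type [kappa], except the
   mark, is replaced by [r u], and the mark, if it has type [kappa], is
   replaced by [top] when the latter is not [None]. *)
Definition block (p : mtree G) (r : seq nat -> tree G) (top : option (tree G)) :
    tree G :=
  let: (t, v) := val p in
  graft (fun u => if (u == [::]) || (vtype t u != Some kappa) then None
                  else if u == v then top else Some (r u)) t.

(* the fringe subtree at $u_i$, together with the marked vertex *)
Fixpoint spine (b : nat -> mtree G) (r : nat -> seq nat -> tree G) (i : nat) :
    tree G * seq nat :=
  if i is j.+1 then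
    let: (t, v) := spine b r j in
    (block (b i) (r i) (Some t), (val (b i)).2 ++ v)
  else (block (b 0%N) (r 0%N) None, (val (b 0%N)).2).

(* The tree [x] built from the blocks [b] and the trees [r]; since the blocks
   with positive index have their mark below the root, the marks of the fringe
   subtrees at the $u_i$ have unbounded height, so that [x] is unique and its
   mark has infinitely many ancestors. *)
Definition built_from (b : nat -> mtree G) (r : nat -> seq nat -> tree G)
    (x : ptree G) : Prop :=
  forall i, exists p : mtree G,
    val p = spine b r i /\ pfringe (size (spine b r i).2) x = (p, false).

Definition part_type (k : nat + nat * seq nat) : countType :=
  match k with inl _ => mtree G | inr _ => tree G end.
Definition part (W : Type) (b : nat -> W -> mtree G)
    (r : nat -> seq nat -> W -> tree G) (k : nat + nat * seq nat) :
    W -> part_type k :=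
  match k with inl i => b i | inr iu => r iu.1 iu.2 end.

Context {R : realType} {d d' : measure_display} {W : measurableType d}
  {W' : measurableType d'}.
Variables (P : probability W R) (P' : probability W' R).

(* [Tk] is $\bm{T}(\kappa)$, [Ts] is $\bm{T}^\kappa$ and [That] is
   $\hat{\bm{T}}(\kappa,\gamma)$, constructed on [W']; [b 0] is distributed
   like $\hat{\bm{T}}^{\kappa,\gamma}$ and [b i], $i \ge 1$, like
   $\hat{\bm{T}}^\kappa$. *)
Definition limit_tree (gamma : G) (Tk Ts : W -> tree G)
    (That : W' -> ptree G) : Prop :=
  exists (b : nat -> W' -> mtree G) (r : nat -> seq nat -> W' -> tree G),
  [/\ (forall k, discrete_rv (part b r k)) /\ mutually_independent P' (part b r),
      forall p, mark_type p = Some gamma ->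
        fine (P' (b 0%N @^-1` [set p])) =
        fine (tree_prob P Ts (val p).1) / fine (mean_nb P gamma Ts),
      forall i p, mark_type p = Some kappa -> (val p).2 != [::] ->
        P' (b i.+1 @^-1` [set p]) = tree_prob P Ts (val p).1,
      forall i u t, P' (r i u @^-1` [set t]) = tree_prob P Tk t &
      {ae P', forall w, built_from (b^~ w) (fun i u => r i u w) (That w)}].
End LimitTree.

(* [L t] is the uniform law on the pairs [(t, v)] with [v] of type [gamma],
   and is arbitrary if there is none. *)
Definition uniform_marking (R : realType) (G : countType) (g0 gamma : G)
    (L : tree G -> weak_probability R (mspace R g0)) : Prop :=
  forall t, (0 < nb_type gamma t)%N ->
  forall A : set (borel_space R g0), measurable A ->
    (L t : probability (borel_space R g0) R) A =
    ((count (fun p => (mark_type p == Some gamma) && `[< A (Fin p) >])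
            (markings t))%:R / (nb_type gamma t)%:R)%:E.

(* Main.v *)
(* A fringe occurrence of (T, v) in a tree is a vertex whose fringe subtree is T:
   the path from that vertex to the mark is dictated by v. Hence N_(T,v) counts
   the fringe subtrees equal to T, and it must be compared with
   P(T(kappa) = T) times the number of vertices of type kappa.

   Put p = P(T(kappa) = T) and give weight b = 1 + delta (1 - p) to the vertices
   whose fringe subtree is T, and a = 1 - delta p to the other vertices of type
   kappa, so that a + (b - a) p = 1. By induction on the depth, the product of
   the weights over a Galton-Watson tree has mean at most 1 for |delta| < 1, of
   either sign and whatever the root type is. Markov's inequality gives, with
   N the number of vertices of type kappa,
   P(|N_(T,v) - p N| > eps N, N >= s) <= 2 exp (- c s) for some c > 0, and the
   conditioning on E_n costs a factor P(E_n)^-1 = o(exp (c s_n)).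

   The limit tree is cut along its spine: f^(kappa,[h]) is assembled from the
   blocks of index at most h, whose laws multiply to P(T(kappa) = T) / E[#_gamma].
   The mean-2 assumption makes the marked blocks probability laws.

   For weak convergence, the sets {f^(kappa,[h]) = (T, v)} are open, disjoint for
   fixed h, and shrink around the limit tree as h grows. For h large, finitely
   many of them on which a given continuous function oscillates by at most eps
   carry mass 1 - eps, and their masses converge by the first part. *)

Require Import Defs.
From mathcomp Require Import all_boot all_order all_algebra.
From mathcomp Require Import finmap.
From mathcomp Require Import all_classical all_reals all_analysis.
From mathcomp Require Import measurable_realfun.
From mathcomp Require Import zify lra ring.

Set Implicit Arguments.
Unset Strict Implicit.
Unset Printing Implicit Defensive.

Import Order.TTheory GRing.Theory Num.Theory.
Import numFieldTopology.Exports numFieldNormedType.Exports.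

Local Open Scope classical_set_scope.
Local Open Scope ring_scope.

(** * Cutting trees at the vertices of type kappa *)

(** The fringe subtrees at the vertices of type [kappa] of one tree overlap, so the counts are not
    sums of independent terms; a product of weights, which factorises over the children of the root,
    avoids this. The identity a + (b - a) p = 1 alone does not bound its mean: at a copy of T the
    subtrees below are no longer random, they are the children of T. These are smaller than T, so
    they carry only the weights a and 1, whose product is at most 1 for delta >= 0 and at least 1
    for delta <= 0. Either way the error has the favourable sign.

    The same identity cancels the first-order terms of (1 - p) ln a + p ln b: the loss per vertex is
    of order delta^2, while a deviation of eps N gains order eps |delta| N. A small delta with the
    sign of the deviation therefore gives a positive rate.

    For the limit tree, only the masses of correctly marked blocks are prescribed; that the blocks
    are almost surely so marked is derived from these masses adding up to one. The rest of the spine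
    analysis is deterministic. *)

Section TreeCombinatorics.
Variables (G : countType) (kappa : G).
Implicit Types (t s T : tree G) (ts : seq (tree G)) (u v w : seq nat).

Lemma subtree_cons i ts k u : subtree (Node i ts) (k :: u) =
  if onth ts k is Some s then subtree s u else None.
Proof. by []. Qed.

Lemma onth_lt (A : Type) (d : A) (l : seq A) k : (k < size l)%N -> onth l k = Some (nth d l k).
Proof. by move=> kl; rewrite onthE (nth_map d). Qed.

Lemma verticesE d i ts : vertices (Node i ts) = [::] ::
  flatten (mkseq (fun k => map (cons k) (vertices (nth d ts k))) (size ts)).
Proof.
rewrite /=; congr (_ :: _); set below := (X in X 0%N ts).
suff H n : below n ts = flatten
    [seq map (cons (n + k)%N) (vertices (nth d ts k)) | k <- iota 0 (size ts)].
  by rewrite H.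
elim: ts n => [//|s l IHl] n /=; rewrite addn0 IHl.
rewrite (iotaDl 1 0) -map_comp; congr (_ ++ flatten _).
by apply: eq_map => k /=; rewrite addnS.
Qed.

Lemma graftE d g i ts : graft g (Node i ts) = if g [::] is Some s then s else
  Node i (mkseq (fun k => graft (fun u => g (k :: u)) (nth d ts k)) (size ts)).
Proof.
rewrite /=; case: (g [::]) => //; congr Node; set below := (X in X 0%N ts).
suff H n : below n ts =
    [seq graft (fun u => g ((n + k)%N :: u)) (nth d ts k) | k <- iota 0 (size ts)].
  by rewrite H.
elim: ts n => [//|s l IHl] n /=; rewrite addn0 IHl.
rewrite (iotaDl 1 0) -map_comp; congr (_ :: _).
by apply: eq_map => k /=; rewrite addnS.
Qed.

Lemma vertices_uniq t : uniq (vertices t).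
Proof.
elim/tree_nested_ind: t => i ts IH; rewrite (verticesE (Node i [::])) cons_uniq.
apply/andP; split.
  by apply/negP => /flattenP[l /mapP[k _ ->]] /mapP[].
have nth_in k : (k < size ts)%N -> nth (Node i [::]) ts k \in ts by exact: mem_nth.
rewrite /mkseq; have: uniq (iota 0 (size ts)) by exact: iota_uniq.
have: forall k, k \in iota 0 (size ts) -> (k < size ts)%N.
  by move=> k; rewrite mem_iota.
elim: (iota _ _) => [//|k l IHl] lt /= /andP[kl ul].
rewrite cat_uniq IHl// ?andbT; last by move=> j jl; apply: lt; rewrite inE jl orbT.
rewrite map_inj_uniq; last by move=> ? ? [].
rewrite IH/=; last by apply/nth_in/lt; rewrite inE eqxx.
apply/hasPn => u /flattenP[_ /mapP[j jl ->]] /mapP[w _ ->].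
by apply/negP => /mapP[w' _ [jk _]]; rewrite -jk jl in kl.
Qed.

Lemma big_vertices_addr (A : Type) (idx : A) (op : Monoid.law idx) d i ts
    (F : seq nat -> A) :
  \big[op/idx]_(u <- vertices (Node i ts)) F u = op (F [::])
    (\big[op/idx]_(k <- iota 0 (size ts))
       \big[op/idx]_(u <- vertices (nth d ts k)) F (k :: u)).
Proof.
rewrite (verticesE d) big_cons big_flatten big_map; congr (op _ _).
by apply: eq_bigr => k _; rewrite big_map.
Qed.

Lemma big_vertices (A : Type) (idx : A) (op : Monoid.law idx) i ts
    (F : option (tree G) -> A) :
  \big[op/idx]_(u <- vertices (Node i ts)) F (subtree (Node i ts) u) =
  op (F (Some (Node i ts)))
    (\big[op/idx]_(s <- ts) \big[op/idx]_(u <- vertices s) F (subtree s u)).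
Proof.
rewrite (big_vertices_addr _ (Node i [::])); congr (op _ _).
rewrite [RHS](big_nth (Node i [::])) /index_iota subn0 !big_seq.
apply: eq_bigr => k; rewrite mem_iota => /= kts; apply: eq_bigr => u _.
by rewrite (onth_lt (Node i [::])).
Qed.

Lemma nb_typeE j i ts :
  nb_type j (Node i ts) = ((i == j) + \sum_(s <- ts) nb_type j s)%N.
Proof.
rewrite /nb_type -sum1_count big_mkcond /vtype.
rewrite (big_vertices _ i ts (fun o => if omap _ o == Some j then 1%N else 0%N)) /=.
congr (_ + _)%N.
by apply: eq_bigr => s _; rewrite -sum1_count [RHS]big_mkcond.
Qed.

Definition occurrences T t : nat :=
  count (fun u => subtree t u == Some T) (vertices t).

Lemma occurrencesE T i ts : occurrences T (Node i ts) =
  ((Node i ts == T) + \sum_(s <- ts) occurrences T s)%N.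
Proof.
rewrite /occurrences -sum1_count big_mkcond.
rewrite (big_vertices _ i ts (fun o => if o == Some T then 1%N else 0%N)).
congr (_ + _)%N.
by apply: eq_bigr => s _; rewrite -sum1_count [RHS]big_mkcond.
Qed.

(** Unlike [cut], this also stops at the root: it is meant for the children of the root, where a
    vertex of type [kappa] always loses its offspring. *)
Fixpoint prune t : tree G := let: Node i ts := t in
  if i == kappa then Node i [::] else Node i (map prune ts).

(* the value of $\bm{T}^\kappa$ when $\bm{T}(\kappa)$ is [t] *)
Definition cut t : tree G := Node (ttype t) (map prune (children t)).

Lemma ttype_prune t : ttype (prune t) = ttype t.
Proof. by case: t => i ts /=; case: ifP. Qed.

Lemma vtype_cons i ts k u : vtype (Node i ts) (k :: u) =
  if onth ts k is Some s then vtype s u else None.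
Proof. by rewrite /vtype /=; case: onth. Qed.

Lemma vtype_prune t u i : vtype (prune t) u = Some i -> vtype t u = Some i.
Proof.
elim/tree_nested_ind: t u => j ts IH [|k u] /=; first by case: ifP.
case: ifP => [_|_]; first by rewrite vtype_cons onth0n.
rewrite !vtype_cons onth_map; case E : (onth ts k) => [s|//] /=.
by apply: IH; apply/onthP; exists k.
Qed.

Lemma prune_leaf t u : vtype (prune t) u = Some kappa ->
  subtree (prune t) u = Some (Node kappa [::]).
Proof.
elim/tree_nested_ind: t u => j ts IH [|k u] /=.
  by case: ifP => [/eqP-> //|/negP jk [/eqP/jk]].
case: ifP => [_|_]; first by rewrite vtype_cons onth0n.
rewrite !vtype_cons /= onth_map; case E : (onth ts k) => [s|//] /=.
by apply: IH; apply/onthP; exists k.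
Qed.

Lemma subtree_prune t u s : subtree t u = Some s ->
  (forall j, (j < size u)%N -> vtype t (take j u) <> Some kappa) ->
  subtree (prune t) u = Some (prune s).
Proof.
elim: u t => [|k u IH] [i ts]; first by case=> <-.
rewrite subtree_cons; case E : (onth ts k) => [c|//] cu H.
have /= := H 0%N isT; rewrite /vtype/= => iK.
rewrite /=; case: eqP => [ik|_]; first by rewrite ik in iK.
rewrite onth_map E/=; apply: IH => // j ju.
by have := H j.+1 ju; rewrite /= vtype_cons E.
Qed.

Lemma prune_subtree t u : subtree (prune t) u -> subtree t u /\
  forall j, (j < size u)%N -> vtype t (take j u) <> Some kappa.
Proof.
elim: u t => [|k u IH] [i ts]; first by [].
rewrite /=; case: ifP => [_|iK]; first by rewrite /= onth0n.
rewrite /= onth_map; case E : (onth ts k) => [c|//] /IH[cu H]; split=> //.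
case=> [_|j ju] /=; first by rewrite /vtype/= => -[/eqP]; rewrite iK.
by rewrite vtype_cons E; apply: H.
Qed.

Lemma vtype_cut t u i : vtype (cut t) u = Some i -> vtype t u = Some i.
Proof.
case: t u => j ts [//|k u]; rewrite /cut !vtype_cons onth_map.
by case: onth => [s|//] /=; exact: vtype_prune.
Qed.

Lemma cut_leaf t u : u != [::] -> vtype (cut t) u = Some kappa ->
  subtree (cut t) u = Some (Node kappa [::]).
Proof.
case: t u => j ts [//|k u] _; rewrite /cut vtype_cons subtree_cons onth_map.
by case: onth => [s|//] /=; exact: prune_leaf.
Qed.

Lemma subtree_cut t u s : u != [::] -> subtree t u = Some s ->
  (forall j, (0 < j < size u)%N -> vtype t (take j u) <> Some kappa) ->
  subtree (cut t) u = Some (prune s).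
Proof.
case: t u => j ts [//|k u] _; rewrite /cut !subtree_cons onth_map.
case E : (onth ts k) => [c|//] /= cu H; apply: subtree_prune => // l lu.
by have := H l.+1 lu; rewrite vtype_cons E.
Qed.

Lemma cut_subtree t u : subtree (cut t) u -> subtree t u /\
  forall j, (0 < j < size u)%N -> vtype t (take j u) <> Some kappa.
Proof.
case: t u => i ts [|k u]; first by split=> // -[].
rewrite /= onth_map; case E : (onth ts k) => [c|//] /= /prune_subtree[cu H].
split=> // -[//|j] /= ju.
by rewrite vtype_cons E; apply: H.
Qed.

(** Pruning and grafting at the leaves of type [kappa] are inverse to each other. The grafted trees
    must have a root of type [kappa], so that pruning turns each of them back into the leaf that it
    replaced. *)
Lemma graft_pruneP g t T :
  (forall u, vtype t u = Some kappa -> subtree t u = Some (Node kappa [::]) /\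
     exists2 s, g u = Some s & ttype s = kappa) ->
  (forall u, subtree t u -> vtype t u <> Some kappa -> g u = None) ->
  graft g t = T <->
  t = prune T /\ forall u, vtype t u = Some kappa -> g u = subtree T u.
Proof.
elim/tree_nested_ind: t g T => i ts IH g T gk gn.
rewrite (graftE (Node i [::])).
have [ik|iN] := eqVneq i kappa.
  have [|/= [_ tsE] [s gE sk]] := gk [::]; first by rewrite /vtype/= ik.
  rewrite gE; rewrite {}tsE {}ik in gk gn IH *; split.
    move=> <-; split; first by move: sk; case: (s) => j l /= ->; rewrite eqxx.
    move=> [//|k u]; by rewrite vtype_cons onth0n.
  move=> [_ /(_ [::] erefl)]; by rewrite gE /= => -[].
rewrite gn//; last by rewrite /vtype/= => -[/eqP]; rewrite (negbTE iN).
set d := Node i [::].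
have kth k : (k < size ts)%N -> nth d ts k \in ts by exact: mem_nth.
have {}IH k T' : (k < size ts)%N ->
    graft (fun u => g (k :: u)) (nth d ts k) = T' <->
    nth d ts k = prune T' /\
    forall u, vtype (nth d ts k) u = Some kappa -> g (k :: u) = subtree T' u.
  move=> kts; apply: IH; first exact: kth.
  - move=> u uk; have := gk (k :: u).
    by rewrite vtype_cons subtree_cons (onth_lt d)//; apply.
  - move=> u su uk; have := gn (k :: u).
    by rewrite vtype_cons subtree_cons (onth_lt d)//; apply.
case: T => i' ts'; split.
  move=> [<- tsE]; have sz : size ts' = size ts by rewrite -tsE size_mkseq.
  have H k : (k < size ts)%N ->
      graft (fun u => g (k :: u)) (nth d ts k) = nth d ts' k.
    by move=> kts; rewrite -tsE nth_mkseq.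
  split; last first.
    move=> [|k u]; first by rewrite /vtype/= => -[/eqP]; rewrite (negbTE iN).
    rewrite vtype_cons subtree_cons; case: (ltnP k (size ts)) => kts.
      rewrite !(onth_lt d) ?sz// => uk.
      by have /(IH _ _ kts)[_] := H _ kts; apply.
    by rewrite onth_default.
  rewrite /= (negbTE iN); congr Node; apply: (@eq_from_nth _ d).
    by rewrite size_map sz.
  move=> k kts; rewrite (nth_map d) ?sz//.
  by have /(IH _ _ kts)[] := H _ kts.
rewrite /=; case: ifP => [/eqP-> [[ik]]|i'N [[ii' tsE] H]].
  by rewrite ik eqxx in iN.
have sz : size ts' = size ts by rewrite tsE size_map.
rewrite -ii'; congr Node; apply: (@eq_from_nth _ d); first by rewrite size_mkseq.
move=> k; rewrite size_mkseq => kts; rewrite nth_mkseq//; apply/(IH _ _ kts).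
split; first by rewrite {1}tsE (nth_map d) ?sz.
move=> u uk; have := H (k :: u); rewrite vtype_cons subtree_cons.
by rewrite !(onth_lt d) ?sz//; apply.
Qed.

Definition leaves t := [seq u <- vertices t | (u != [::]) && (vtype t u == Some kappa)].

Lemma mem_leaves t u :
  (u \in leaves t) = (u != [::]) && (vtype t u == Some kappa).
Proof.
rewrite mem_filter mem_vertices /vtype; case: (u != _) => //=.
by case: subtree => // s; rewrite andbT.
Qed.

(** Cutting inverts the assembly of a block. An equation between assembled trees thus becomes one
    equation for the block and one for each grafted tree, a form in which the independence of the
    parts can be used. *)
Lemma blockP (p : mtree G) r top T :
  (forall u, u \in leaves (val p).1 -> subtree (val p).1 u = Some (Node kappa [::])) ->
  ((val p).2 \in leaves (val p).1 -> exists2 s, top = Some s & ttype s = kappa) ->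
  (forall u, ttype (r u) = kappa) ->
  block kappa p r top = T <-> (val p).1 = cut T /\ forall u, u \in leaves (val p).1 ->
    (if u == (val p).2 then top else Some (r u)) = subtree T u.
Proof.
case Ep : (val p) => [[i ts] v]; rewrite /block Ep /fst /snd => pk topk rk.
pose g u := if (u == [::]) || (vtype (Node i ts) u != Some kappa) then None
  else if u == v then top else Some (r u).
set d := Node i [::].
have IH k T' : (k < size ts)%N ->
    graft (fun u => g (k :: u)) (nth d ts k) = T' <->
    nth d ts k = prune T' /\
    forall u, vtype (nth d ts k) u = Some kappa -> g (k :: u) = subtree T' u.
  move=> kts.
  have vk u : vtype (Node i ts) (k :: u) = vtype (nth d ts k) u.
    by rewrite vtype_cons (onth_lt d).
  apply: graft_pruneP => u.
    move=> uk; split.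
      have := pk (k :: u); rewrite mem_leaves vk uk eqxx subtree_cons.
      by rewrite (onth_lt d)//; apply.
    rewrite /g /= vk uk eqxx /=; case: eqP => [kuv|_]; last by exists (r (k :: u)).
    by apply: topk; rewrite -kuv mem_leaves vk uk eqxx.
  by move=> _ uk; rewrite /g /= vk; case: eqP => // /uk.
rewrite -/g (graftE d); have -> : g [::] = None by [].
case: T => i' ts'; split.
  move=> [<- tsE]; have sz : size ts' = size ts by rewrite -tsE size_mkseq.
  have H k : (k < size ts)%N ->
      graft (fun u => g (k :: u)) (nth d ts k) = nth d ts' k.
    by move=> kts; rewrite -tsE nth_mkseq.
  split; last first.
    move=> [|k u]; rewrite mem_leaves//= vtype_cons.
    case: (ltnP k (size ts)) => kts; last by rewrite onth_default.
    rewrite !(onth_lt d) ?sz// => /eqP uk.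
    have /(IH _ _ kts)[_ /(_ u uk) <-] := H _ kts.
    by rewrite /g /= vtype_cons (onth_lt d)// uk eqxx.
  rewrite /cut /=; congr Node; apply: (@eq_from_nth _ d).
    by rewrite size_map sz.
  move=> k kts; rewrite (nth_map d) ?sz//.
  by have /(IH _ _ kts)[] := H _ kts.
rewrite /cut /= => -[[ii' tsE] H].
have sz : size ts' = size ts by rewrite tsE size_map.
rewrite -ii'; congr Node; apply: (@eq_from_nth _ d); first by rewrite size_mkseq.
move=> k; rewrite size_mkseq => kts; rewrite nth_mkseq//; apply/(IH _ _ kts).
split; first by rewrite {1}tsE (nth_map d) ?sz.
move=> u uk; have := H (k :: u); rewrite mem_leaves vtype_cons /=.
rewrite !(onth_lt d) ?sz// uk eqxx => /(_ isT) <-.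
by rewrite /g/= vtype_cons (onth_lt d)// uk eqxx.
Qed.

End TreeCombinatorics.

(** * Vertices of type [kappa] on the path to the mark *)

Section MarkedTrees.
Variables (G : countType) (kappa : G).
Implicit Types (t T : tree G) (p : mtree G) (u v w : seq nat) (x : ptree G).

Lemma vtype_cat t u w s : subtree t u = Some s -> vtype t (u ++ w) = vtype s w.
Proof. by rewrite /vtype subtree_cat => ->. Qed.

Lemma kpath_cat p p1 w : (val p).2 = w ++ (val p1).2 ->
  subtree (val p).1 w = Some (val p1).1 ->
  kpath kappa p =
  (count (fun k => vtype (val p).1 (take k w) == Some kappa) (iota 0 (size w)) +
   kpath kappa p1)%N.
Proof.
move=> vE tw; rewrite /kpath vE size_cat -addnS iotaD count_cat; congr (_ + _)%N.
  apply: eq_in_count => k; rewrite mem_iota => /= kw.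
  by rewrite takel_cat// ltnW.
rewrite add0n -[X in iota X _]addn0 iotaDl count_map; apply: eq_count => k /=.
by rewrite takeD drop_size_cat// take_size_cat// (vtype_cat _ tw).
Qed.

(** Strictly between the root and a leaf of the cut tree no vertex has type [kappa], so only the
    root is added to the count. *)
Lemma kpath_leaf p p1 w : mroot_type p = kappa -> w \in leaves kappa (cut kappa (val p).1) ->
  (val p).2 = w ++ (val p1).2 -> subtree (val p).1 w = Some (val p1).1 ->
  kpath kappa p = (kpath kappa p1).+1.
Proof.
move=> pk wl vE tw; rewrite (kpath_cat vE tw) -add1n; congr (_ + _)%N.
have cw : subtree (cut kappa (val p).1) w.
  by move: wl; rewrite mem_filter mem_vertices => /andP[].
have [_] := cut_subtree cw.
move: wl; rewrite mem_leaves; case: w vE tw cw => [//|k w] vE tw cw /= _ wN.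
rewrite /vtype /=; have -> : ttype (val p).1 = kappa by [].
rewrite eqxx; apply/eqP; rewrite eqSS -leqn0 leqNgt -has_count.
apply/negP => /hasP[j]; rewrite mem_iota add1n => j0 /eqP; exact: wN.
Qed.

Lemma kpath_root p : mroot_type p = kappa -> kpath kappa p =
  (count (fun k => vtype (val p).1 (take k (val p).2) == Some kappa)
    (iota 1 (size (val p).2))).+1.
Proof.
move=> pk; rewrite /kpath -[(size _).+1]add1n iotaD count_cat /= take0.
by have -> : vtype (val p).1 [::] == Some kappa by exact/eqP/(congr1 Some).
Qed.

Lemma kpath1 p : mroot_type p = kappa -> kpath kappa p = 1%N ->
  forall j, (0 < j <= size (val p).2)%N ->
  vtype (val p).1 (take j (val p).2) <> Some kappa.
Proof.
move=> pk; rewrite kpath_root// => -[] c0 j jv jk.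
have : has (fun k => vtype (val p).1 (take k (val p).2) == Some kappa)
    (iota 1 (size (val p).2)).
  by apply/hasP; exists j; [rewrite mem_iota add1n ltnS|exact/eqP].
by rewrite has_count c0.
Qed.

(** The vertex [w] is the first one of type [kappa] below the root on the way to the mark; by
    minimality it survives the cut and becomes a leaf. *)
Lemma kpath_split p h : mroot_type p = kappa -> kpath kappa p = h.+2 ->
  exists w p1, [/\ (val p).2 = w ++ (val p1).2, w \in leaves kappa (cut kappa (val p).1),
    subtree (val p).1 w = Some (val p1).1 & mroot_type p1 = kappa] .
Proof.
move=> pk kp; set t := (val p).1; set v := (val p).2.
pose Q j := (0 < j <= size v)%N && (vtype t (take j v) == Some kappa).
have exQ : exists j, Q j.
  move: kp; rewrite kpath_root// => -[] c.
  have : has (fun k => vtype (val p).1 (take k (val p).2) == Some kappa)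
      (iota 1 (size (val p).2)) by rewrite has_count c.
  move=> /hasP[j]; rewrite mem_iota add1n ltnS => jv jk.
  by exists j; rewrite /Q jv.
have [j /andP[/andP[j0 jv] /eqP jk] jmin] := ex_minnP exQ.
have : vtype t (take j v) = Some kappa := jk.
rewrite {1}/vtype; case tE : (subtree t _) => [s|//] /= -[sk].
have sv : subtree s (drop j v) : bool.
  by have := valP p; rewrite -/t -/v -{1}(cat_take_drop j v) subtree_cat tE.
have t0 : take j v != [::] by rewrite -size_eq0 size_takel// -lt0n.
exists (take j v), (exist _ (s, drop j v) sv); split=> //=.
  by rewrite cat_take_drop.
rewrite mem_leaves t0 /= /vtype (subtree_cut (s := s) t0) //=.
  by rewrite ttype_prune sk.
move=> i; rewrite size_takel// => /andP[i0 ij]; rewrite take_takel 1?ltnW// => ik.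
have := jmin i; rewrite /Q i0 ik eqxx andbT /= (leqNgt j) ij.
by rewrite (leq_trans (ltnW ij) jv) => /(_ isT).
Qed.

(** The leaves form an antichain, nothing being left below them after the cut. Hence the block
    containing the root of a marked tree has only one possible mark. *)
Lemma leaf_prefix_uniq t v w w' : w \in leaves kappa (cut kappa t) ->
  w' \in leaves kappa (cut kappa t) -> prefix w v -> prefix w' v -> w = w'.
Proof.
wlog sz : w w' / (size w <= size w')%N => [H wl wl' wv wv'|].
  by case/orP: (leq_total (size w) (size w')) => s; [apply: H|apply/esym/H].
move=> wl wl' /prefixP[x vE] /prefixP[x' vE'].
have wE : w = take (size w) w'.
  by rewrite -(takel_cat x' sz) -vE' vE take_size_cat.
move: sz; rewrite leq_eqVlt => /orP[/eqP sz|sz].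
  by rewrite wE sz take_size.
move: wl; rewrite mem_leaves => /andP[w0 /eqP wk].
move: wl'; rewrite mem_leaves => /andP[_ /eqP].
rewrite -(cat_take_drop (size w) w') -wE.
rewrite (vtype_cat _ (cut_leaf w0 wk)).
have := size_drop (size w) w'; case: (drop _ _) => [|k y] /=.
  by move=> /esym /eqP; rewrite subn_eq0 leqNgt sz.
by rewrite vtype_cons onth0n.
Qed.

Lemma pfringe_size m x : ~~ (pfringe m x).2 -> size (val (pfringe m x).1).2 = m.
Proof.
case: x => [p|[f Hf]] /=; last by rewrite (Hf m).1.
by case: (leqP m (size (val p).2)) => hp; [rewrite fringe_size|rewrite /fringe leqNgt hp].
Qed.

(** Turns a search for the right ancestor into a condition at one fixed height. A smaller candidate
    is impossible: its [h.+1] vertices of type [kappa] would lie strictly below the root of [p],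
    which has type [kappa] as well and would make the total at least [h.+2]. *)
Lemma kfringeP p h x : mroot_type p = kappa -> kpath kappa p = h.+1 ->
  kfringe kappa h x = (Fin p, false) <-> pfringe (size (val p).2) x = (p, false).
Proof.
move=> pk kp; rewrite /kfringe; case: pselect => [ex|nex]; split.
- case: ex_minnP => m /and3P[m1 _ _] _ [] mE; rewrite -{1}mE pfringe_size//.
  by rewrite [LHS]surjective_pairing mE (negbTE m1).
- set m0 := size _ => m0E.
  case: ex_minnP => m /and3P[m1 /eqP m2 /eqP m3] /(_ m0); rewrite /kfringe_at m0E /= pk kp.
  rewrite !eqxx => /(_ isT); rewrite leq_eqVlt => /orP[/eqP->|mm0]; first by rewrite m0E.
  exfalso; move: (pfringe_comp x (ltnW mm0)) m1 m2 m3; rewrite m0E /= => <- m1 m2 m3.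
  have mm : (m <= size (val p).2)%N by exact: ltnW.
  have [/esym e1 e2] := fringe_val mm.
  have : (val p).2 = take (m0 - m) (val p).2 ++ (val (fringe m p).1).2.
    by rewrite e2 cat_take_drop.
  move=> /kpath_cat /(_ e1); rewrite kp m3 size_takel ?leq_subr//.
  have : (0 < m0 - m)%N by rewrite subn_gt0.
  case: (m0 - m)%N => [//|k] _ /=; rewrite take0 /vtype /= [ttype _]pk eqxx.
  by move=> /eqP; rewrite addSn eqSS -{1}[h.+1]add0n addnC; lia.
- by case.
- move=> xE; exfalso; apply: nex; exists (size (val p).2).
  by rewrite /kfringe_at xE /= pk kp !eqxx.
Qed.

Lemma fringeP m p q : (fringe m q = (p, false) /\ size (val p).2 = m) <->
  exists2 w, (val q).2 = w ++ (val p).2 &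
    subtree (val q).1 w = Some (val p).1 /\ size (val p).2 = m.
Proof.
split.
  move=> [qE pm]; have mq : (m <= size (val q).2)%N.
    by rewrite leqNgt; apply/negP => mq; move: qE; rewrite /fringe leqNgt mq.
  have [e1 e2] := fringe_val mq; exists (take (size (val q).2 - m) (val q).2).
    by rewrite -[p]/(p, false).1 -qE e2 cat_take_drop.
  by rewrite -e1 qE.
move=> [w qE [qw pm]]; split=> //.
have mq : (m <= size (val q).2)%N by rewrite qE size_cat pm leq_addl.
have [e1 e2] := fringe_val mq.
have sz : (size (val q).2 - m)%N = size w by rewrite qE size_cat pm addnK.
rewrite [LHS]surjective_pairing; congr pair; last by rewrite /fringe mq.
apply: val_inj; rewrite [LHS]surjective_pairing [RHS]surjective_pairing.
congr pair; last by rewrite e2 sz qE drop_size_cat.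
by apply: Some_inj; rewrite e1 sz qE take_size_cat.
Qed.

Lemma count_markings (a : pred (tree G * seq nat)) t :
  count (fun p => a (val p)) (markings t) = count (fun u => a (t, u)) (vertices t).
Proof.
rewrite -(count_map val) /markings (pmap_filter (insubK _)).
rewrite (eq_in_filter (a2 := predT)) ?filter_predT; last first.
  by move=> q /mapP[u ut ->] /=; rewrite insubT//= -mem_vertices.
by rewrite count_map.
Qed.

(* The vertices counted by [Noccur] are exactly the [w ++ (val p).2] with [w]
   such that the fringe subtree at [w] is [(val p).1]. *)
Lemma NoccurE p h t : mroot_type p = kappa -> kpath kappa p = h.+1 ->
  Noccur kappa h p t = occurrences (val p).1 t.
Proof.
move=> pk kp; set v := (val p).2.
pose a (q : tree G * seq nat) :=
  `[< exists2 w, q.2 = w ++ v & subtree q.1 w = Some (val p).1 >].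
transitivity (count (fun q => a (val q)) (markings t)).
  apply: eq_count => q; apply/asboolP/asboolP.
    move=> /(kfringeP _ pk kp) qE.
    by have [w ? []] := (fringeP _ _ _).1 (conj qE erefl); exists w.
  move=> [w w1 w2]; apply/(kfringeP _ pk kp).
  by have [] := (fringeP (size v) p q).2 (ex_intro2 _ _ w w1 (conj w2 erefl)).
rewrite count_markings /occurrences -!size_filter 
  -(size_map (fun w => w ++ v) [seq w <- _ | subtree t w == Some (val p).1]).
apply: perm_size; apply: uniq_perm; first exact/filter_uniq/vertices_uniq.
  rewrite map_inj_uniq; first exact/filter_uniq/vertices_uniq.
  move=> w w' E; have sz : size w = size w'.
    by have := congr1 size E; rewrite !size_cat => /addIn.
  by move/eqP: E; rewrite eqseq_cat// => /andP[/eqP].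
move=> u; rewrite mem_filter; apply/andP/mapP.
  move=> [/asboolP[w /= -> tw] _]; exists w => //.
  by rewrite mem_filter tw eqxx mem_vertices tw.
move=> [w]; rewrite mem_filter => /andP[/eqP tw wt] ->; split.
  by apply/asboolP; exists w.
by rewrite mem_vertices subtree_cat tw /=; exact: (valP p).
Qed.

End MarkedTrees.

(** * Exponential moments of fringe subtree counts *)

Section FiniteSums.
Variables (R : realType).

Lemma sum_uniq_sub (I : eqType) (A B : seq I) (F : I -> R) :
  (forall i, 0 <= F i) -> uniq A -> uniq B -> {subset A <= B} ->
  \sum_(i <- A) F i <= \sum_(i <- B) F i.
Proof.
move=> F0 uA uB AB; rewrite [leRHS](bigID (mem A)) /=.
have -> : \sum_(i <- B | i \in A) F i = \sum_(i <- A) F i.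
  rewrite -big_filter; apply: perm_big; apply: uniq_perm => //.
    exact: filter_uniq.
  by move=> i; rewrite mem_filter; case: (boolP (i \in A)) => // /AB ->.
by rewrite lerDl sumr_ge0.
Qed.

Lemma sum_partition (I J : eqType) (k : I -> J) (A : seq I) (F : I -> R) :
  \sum_(i <- A) F i =
  \sum_(j <- undup (map k A)) \sum_(i <- A | k i == j) F i.
Proof.
under [RHS]eq_bigr do rewrite big_mkcond.
rewrite exchange_big /= big_seq [RHS]big_seq; apply: eq_bigr => i iA.
rewrite -big_mkcond /= -big_filter (eq_filter (a2 := pred1 (k i))); last first.
  by move=> j; rewrite /= eq_sym.
by rewrite filter_pred1_uniq ?undup_uniq ?big_seq1// mem_undup map_f.
Qed.

Lemma prodr_le1 (I : eqType) (A : seq I) (F : I -> R) :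
  (forall i, i \in A -> 0 <= F i <= 1) -> \prod_(i <- A) F i <= 1.
Proof.
by move=> F01; rewrite big_seq; apply: prodr_ile1 => i; exact: F01.
Qed.

Lemma prodr_ge1 (I : eqType) (A : seq I) (F : I -> R) :
  (forall i, i \in A -> 1 <= F i) -> 1 <= \prod_(i <- A) F i.
Proof.
move=> F1; rewrite big_seq; apply: (big_ind (fun x => 1 <= x)) => //.
by move=> x y; exact: mulr_ege1.
Qed.
End FiniteSums.

Section TreeWeights.
Variables (R : realType) (G : countType) (q : G -> seq G -> R).
Implicit Types (t s T : tree G) (ts : seq (tree G)).

Definition offspring_weight (o : option (tree G)) : R :=
  if o is Some s then q (ttype s) (map (@ttype G) (children s)) else 1.

(** When [q] is the offspring law, this is the probability that the Galton-Watson tree started from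
    the root type of [t] equals [t]. *)
Definition tree_weight t : R := \prod_(u <- vertices t) offspring_weight (subtree t u).

(** The analogue for the tree stopped at type [kappa]: the non-root vertices of type [kappa] give no
    factor, their empty offspring being certain. *)
Definition stopped_weight kappa t : R :=
  \prod_(u <- vertices t | (u == [::]) || (vtype t u != Some kappa))
    offspring_weight (subtree t u).

Lemma tree_weightE i ts : tree_weight (Node i ts) =
  q i (map (@ttype G) ts) * \prod_(s <- ts) tree_weight s.
Proof. by rewrite /tree_weight big_vertices. Qed.

Lemma tree_weight_prune kappa T : tree_weight T =
  \prod_(u <- vertices (prune kappa T))
    (if vtype (prune kappa T) u == Some kappa then tree_weight (odflt T (subtree T u))
     else offspring_weight (subtree (prune kappa T) u)).
Proof.
suff H d : tree_weight T =
  \prod_(u <- vertices (prune kappa T))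
    (if vtype (prune kappa T) u == Some kappa then tree_weight (odflt d (subtree T u))
     else offspring_weight (subtree (prune kappa T) u)) by exact: H.
elim/tree_nested_ind: T => i ts IH /=; case: ifPn => [/eqP->|ik].
  by rewrite (verticesE d) /= big_cons big_nil /vtype /= eqxx mulr1.
rewrite (big_vertices_addr _ d) tree_weightE {1}/vtype /= ifN; last first.
  by apply: contra ik => /eqP[->].
congr (_ * _).
  by rewrite -map_comp; congr q; apply: eq_map => s /=; rewrite ttype_prune.
rewrite size_map (big_nth d) /index_iota subn0 big_seq [RHS]big_seq.
apply: eq_bigr => k; rewrite mem_iota => /= kts; rewrite (nth_map d)//.
rewrite IH ?mem_nth//; apply: eq_bigr => u _.
by rewrite vtype_cons onth_map (onth_lt d).
Qed.

(** In terms of laws: a Galton-Watson tree with root type [kappa] is the stopped tree with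
    independent copies of the full tree at its leaves. Repeated along the spine, this factorisation
    gives the law of the limit tree. *)
Lemma tree_weight_cut kappa T : tree_weight T = stopped_weight kappa (cut kappa T) *
  \prod_(u <- leaves kappa (cut kappa T)) tree_weight (odflt T (subtree T u)).
Proof.
rewrite /stopped_weight /leaves big_filter.
rewrite [X in X * _](eq_bigl (fun u =>
  ~~ ((u != [::]) && (vtype (cut kappa T) u == Some kappa)))); last first.
  by move=> u; rewrite negb_and negbK.
rewrite mulrC; transitivity (\prod_(u <- vertices (cut kappa T))
    if (u != [::]) && (vtype (cut kappa T) u == Some kappa)
    then tree_weight (odflt T (subtree T u))
    else offspring_weight (subtree (cut kappa T) u)); last first.
  rewrite (bigID (fun u => (u != [::]) && (vtype (cut kappa T) u == Some kappa))) /=.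
  by congr (_ * _); apply: eq_bigr => u; [move=> ->|move=> /negbTE ->].
suff H d : tree_weight T = \prod_(u <- vertices (cut kappa T))
    if (u != [::]) && (vtype (cut kappa T) u == Some kappa)
    then tree_weight (odflt d (subtree T u))
    else offspring_weight (subtree (cut kappa T) u) by exact: H.
case: T => i ts; rewrite /cut (big_vertices_addr _ d) tree_weightE /=.
congr (_ * _).
  by rewrite -map_comp; congr q; apply: eq_map => s /=; rewrite ttype_prune.
rewrite size_map (big_nth d) /index_iota subn0 big_seq [RHS]big_seq.
apply: eq_bigr => k; rewrite mem_iota => /= kts; rewrite (nth_map d)//.
rewrite (tree_weight_prune kappa); apply: eq_bigr => u _.
rewrite vtype_cons onth_map (onth_lt d)//=; case: ifP => // /eqP uk.
have : subtree (nth d ts k) u.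
  by have := vtype_prune uk; rewrite /vtype; case: subtree.
by case: (subtree _ u).
Qed.

Hypothesis q_ge0 : forall i w, 0 <= q i w.
Hypothesis q_mass : forall i (A : seq (seq G)), uniq A -> \sum_(w <- A) q i w <= 1.

Lemma tree_weight_ge0 t : 0 <= tree_weight t.
Proof. by apply: prodr_ge0 => u _; rewrite /offspring_weight; case: subtree. Qed.

(** A mean of at most 1 from every root type, expressed on finite lists so that no integral is
    involved. The root type is fixed because the types of the children are prescribed when one
    generation is added. *)
Definition submass (g : tree G -> R) := forall i (S : seq (tree G)), uniq S ->
  \sum_(t <- S | ttype t == i) g t <= 1.

(** Induction on the word of root types: a finite set of forests lies in the product of the set of
    its first trees and the set of its remainders, and the sum over a product set factorises. *)
Lemma submass_forest g : (forall t, 0 <= g t) -> submass g ->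
  forall w (L : seq (seq (tree G))), uniq L ->
  \sum_(ts <- L | map (@ttype G) ts == w) \prod_(s <- ts) g s <= 1.
Proof.
move=> g0 gm; elim=> [|i w IH] L uL.
  apply: (@le_trans _ _ (\sum_(ts <- [:: [::]]) \prod_(s <- ts) g s)).
    rewrite -big_filter; apply: sum_uniq_sub => //.
    - by move=> ts; exact: prodr_ge0.
    - exact: filter_uniq.
    - by move=> [|t ts]; rewrite mem_filter inE.
  by rewrite big_seq1 big_nil.
set H := undup [seq head (Node i [::]) ts | ts <- L].
set B := undup [seq behead ts | ts <- L].
apply: (@le_trans _ _ (\sum_(l <- [seq t :: ts | t <- [seq t <- H | ttype t == i],
    ts <- [seq ts <- B | map (@ttype G) ts == w]]) \prod_(s <- l) g s)).
  rewrite -big_filter; apply: sum_uniq_sub.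
  - by move=> ts; exact: prodr_ge0.
  - exact: filter_uniq.
  - apply: allpairs_uniq; try exact/filter_uniq/undup_uniq.
    by move=> [? ?] [? ?] _ _ [-> ->].
  - move=> [|t ts]; rewrite mem_filter//= => /andP[/eqP[ti tw] tL].
    apply/allpairsP; exists (t, ts); rewrite !mem_filter /= ti tw !eqxx !mem_undup.
    by split=> //; apply/mapP; exists (t :: ts).
rewrite big_allpairs_dep big_filter; apply: le_trans (gm i H (undup_uniq _)).
apply: ler_sum => t _; rewrite big_filter.
under eq_bigr do rewrite big_cons.
by rewrite -mulr_sumr ler_piMr// IH// undup_uniq.
Qed.

(** One generation of branching: once the word of children types is fixed, its weight comes out of
    the sum and the forest below contributes at most 1. *)
Lemma submass_node (V : tree G -> R) : (forall t, 0 <= V t) ->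
  submass (fun t => tree_weight t * V t) ->
  submass (fun t => tree_weight t * \prod_(s <- children t) V s).
Proof.
move=> V0 Vm i S uS; rewrite -big_filter.
set A := [seq t <- S | ttype t == i]; pose L := [seq children t | t <- A].
have uL : uniq L.
  rewrite map_inj_in_uniq; first exact: filter_uniq.
  move=> [j ts] [j' ts']; rewrite !mem_filter /=.
  by move=> /andP[/eqP-> _] /andP[/eqP-> _] ->.
set F := fun ts => \prod_(s <- ts) (tree_weight s * V s).
have -> : \sum_(t <- A) (tree_weight t * \prod_(s <- children t) V s) =
    \sum_(ts <- L) (q i (map (@ttype G) ts) * F ts).
  rewrite /L big_map /A !big_filter; apply: eq_bigr => -[j ts] /= /eqP->.
  by rewrite tree_weightE -mulrA -big_split.
rewrite (sum_partition (map (@ttype G))).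
apply: le_trans (q_mass i (undup_uniq (map (map (@ttype G)) L))).
apply: ler_sum => w _; under eq_bigr => ts /eqP -> do over.
rewrite -mulr_sumr ler_piMr// submass_forest// => t.
by rewrite mulr_ge0 ?tree_weight_ge0.
Qed.

Variable f : tree G -> R.
Hypothesis f_ge0 : forall t, 0 <= f t.

(* [z = 0] keeps the trees of height less than [n] only; [z = 1] keeps all trees
   and drops the factors below depth [n]. *)
Fixpoint trunc_prod z n t : R :=
  if n is m.+1 then f t * \prod_(s <- children t) trunc_prod z m s else z.

Lemma trunc_prod_ge0 z n t : 0 <= z -> 0 <= trunc_prod z n t.
Proof.
move=> z0; elim: n t => [//|n IH] t /=.
by rewrite mulr_ge0// prodr_ge0.
Qed.

Definition fringe_prod t := \prod_(u <- vertices t) (oapp f 1 (subtree t u)).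

Lemma fringe_prodE i ts : fringe_prod (Node i ts) =
  f (Node i ts) * \prod_(s <- ts) fringe_prod s.
Proof. by rewrite /fringe_prod big_vertices. Qed.

Lemma size_vertices_child i ts s : s \in ts ->
  (size (vertices s) < size (vertices (Node i ts)))%N.
Proof.
move=> sts; rewrite -!sum1_size (big_vertices _ i ts (fun=> 1%N)) /= add1n ltnS.
by rewrite (big_rem s)// leq_addr.
Qed.

Lemma trunc_prodE z n t : (size (vertices t) <= n)%N -> trunc_prod z n t = fringe_prod t.
Proof.
elim: n t => [|n IH] [i ts] tn; first by rewrite (verticesE (Node i [::])) in tn.
rewrite /= fringe_prodE; congr (_ * _); rewrite big_seq [RHS]big_seq.
by apply: eq_bigr => s sts; rewrite IH// -ltnS (leq_trans (size_vertices_child i sts)).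
Qed.

(** A finite list of trees has bounded height, so a deep enough truncation is exact on it. The total
    number of vertices serves as depth. *)
Lemma submass_fringe z : 0 <= z ->
  (forall n, submass (fun t => tree_weight t * trunc_prod z n t)) ->
  submass (fun t => tree_weight t * fringe_prod t).
Proof.
move=> z0 H i S uS; have := H (\sum_(t <- S) size (vertices t))%N i S uS.
congr (_ <= _); rewrite big_seq_cond [RHS]big_seq_cond; apply: eq_bigr => t /andP[tS _].
by rewrite trunc_prodE// (big_rem t)// leq_addr.
Qed.
End TreeWeights.

Section Supermartingale.
Variables (R : realType) (G : countType) (q : G -> seq G -> R).
Hypothesis q_ge0 : forall i w, 0 <= q i w.
Hypothesis q_mass : forall i (A : seq (seq G)), uniq A -> \sum_(w <- A) q i w <= 1.
Local Notation weight := (tree_weight q).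

(** With all factors equal to 1 and [z = 0], the truncated product is the indicator of height less
    than [n], and the induction starts from an empty sum of masses. *)
Lemma submass_tree_weight : submass weight.
Proof.
have H n : submass (fun t => weight t * trunc_prod (fun=> 1) 0 n t).
  elim: n => [|n IH] i S uS /=; first by rewrite big1// => t _; rewrite mulr0.
  under eq_bigr do rewrite mul1r.
  apply: submass_node => //; first by move=> t; exact: trunc_prod_ge0.
have := submass_fringe (lexx 0) H.
move=> {}H i S uS; have := H i S uS; congr (_ <= _); apply: eq_bigr => t _.
by rewrite /fringe_prod big1 ?mulr1// => u _; case: subtree.
Qed.

(** * The tilted product has mean at most one *)

Variables (kappa : G) (T : tree G) (delta : R).
Hypotheses (Tk : ttype T = kappa) (delta1 : `|delta| < 1).

(* The two values [b] and [a] satisfy [a + (b - a) * weight T = 1]. *)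
Definition tilt_factor t : R :=
  if t == T then 1 + delta * (1 - weight T)
  else if ttype t == kappa then 1 - delta * weight T else 1.

Lemma weight01 : 0 <= weight T <= 1.
Proof.
rewrite tree_weight_ge0//=; have := submass_tree_weight (ttype T) (S := [:: T]) isT.
by rewrite big_mkcond big_seq1 eqxx.
Qed.

Lemma tilt_a_gt0 : 0 < 1 - delta * weight T.
Proof.
have /andP[w0 w1] := weight01; move: delta1; rewrite ltr_norml => /andP[? ?]; nra.
Qed.

Lemma tilt_b_gt0 : 0 < 1 + delta * (1 - weight T).
Proof.
have /andP[w0 w1] := weight01; move: delta1; rewrite ltr_norml => /andP[? ?]; nra.
Qed.

Lemma tilt_gt0 t : 0 < tilt_factor t.
Proof.
rewrite /tilt_factor; case: ifP => _; first exact: tilt_b_gt0.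
by case: ifP => _ //; exact: tilt_a_gt0.
Qed.

(** A tree with fewer vertices than [T] contains no copy of [T]. Its only factors are 1 and
    [1 - delta * weight T], all on the same side of 1. *)
Lemma tilt_trunc n t : (size (vertices t) < size (vertices T))%N ->
  (0 <= delta -> trunc_prod tilt_factor 1 n t <= 1) /\
  (delta <= 0 -> 1 <= trunc_prod tilt_factor 1 n t).
Proof.
have /andP[w0 w1] := weight01.
elim: n t => [//|n IH] [i ts] tT; split=> d0 /=.
  apply: mulr_ile1.
  - exact/ltW/tilt_gt0.
  - by apply: prodr_ge0 => s _; apply: trunc_prod_ge0 => // ?; exact/ltW/tilt_gt0.
  - rewrite /tilt_factor ifN; last by apply: contraTneq tT => ->; rewrite ltnn.
    by case: ifP => // _; nra.
  - apply: prodr_le1 => s sts; rewrite trunc_prod_ge0//=; last first.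
      by move=> ?; exact/ltW/tilt_gt0.
    by apply: (IH s _).1 => //; apply: ltn_trans tT; exact: size_vertices_child.
rewrite mulr_ege1//.
  rewrite /tilt_factor ifN; last by apply: contraTneq tT => ->; rewrite ltnn.
  by case: ifP => // _; nra.
apply: prodr_ge1 => s sts.
by apply: (IH s _).2 => //; apply: ltn_trans tT; exact: size_vertices_child.
Qed.

(** Let a be [1 - delta * weight T], the weight of the other vertices of type [kappa]. The weight at
    [T] is a + delta, so one generation gives at most a + delta * weight T * X, with X the truncated
    product over the children of [T]. This is at most 1 exactly when delta * weight T * (1 - X) >=
    0, which follows from [tilt_trunc]. *)
Lemma submass_tilt : submass (fun t => weight t * fringe_prod tilt_factor t).
Proof.
have tilt_ge0 t : 0 <= tilt_factor t by exact/ltW/tilt_gt0.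
apply: (submass_fringe ler01) => n.
elim: n => [|n IH] i S uS /=.
  by under eq_bigr do rewrite mulr1; exact: submass_tree_weight.
pose V := trunc_prod tilt_factor 1 n.
have V0 t : 0 <= V t by exact: trunc_prod_ge0.
have nodes := submass_node q_ge0 q_mass V0 IH.
have [ik|ik] := eqVneq i kappa; last first.
  rewrite (eq_bigr (fun t => weight t * \prod_(s <- children t) V s)); first exact: nodes.
  move=> t /eqP ti; rewrite /tilt_factor ifN; last first.
    by apply: contraNneq ik => tT; rewrite -ti tT Tk.
  by rewrite ti (negbTE ik) mul1r.
(* For negative [delta] the weight a may exceed 1 and only the term at [T] compensates for it. So
   [T] is added to the list, which can only increase the sum. *)
pose S' := if T \in S then S else T :: S.
have uS' : uniq S' by rewrite /S'; case: ifPn => //= -> .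
have TS' : T \in S' by rewrite /S'; case: ifPn => //=; rewrite inE eqxx.
apply: (@le_trans _ _ (\sum_(t <- S' | ttype t == i)
    weight t * (tilt_factor t * \prod_(s <- children t) V s))).
  rewrite /S'; case: ifP => // _; rewrite big_cons Tk ik eqxx lerDr.
  by rewrite mulr_ge0 ?tree_weight_ge0// mulr_ge0// prodr_ge0.
pose a := 1 - delta * weight T.
rewrite (eq_bigr (fun t => a * (weight t * \prod_(s <- children t) V s) +
   (if t == T then delta * weight T * \prod_(s <- children T) V s else 0))); last first.
  move=> t /eqP ti; rewrite /tilt_factor ti ik eqxx.
  by case: eqP => [->|_]; rewrite /a; ring.
rewrite big_split /= -mulr_sumr -big_mkcondr /= -[X in _ + X]big_filter.
have -> : [seq t <- S' | (ttype t == i) & t == T] = [:: T].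
  rewrite -(filter_pred1_uniq uS' TS'); apply: eq_filter => t /=.
  by case: (t =P T) => [->|_]; rewrite ?andbF// Tk ik eqxx.
rewrite big_seq1.
have a0 : 0 < a := tilt_a_gt0.
apply: (@le_trans _ _ (a * 1 + delta * weight T * \prod_(s <- children T) V s)).
  by rewrite lerD2r ler_pM2l//; exact: nodes.
suff : 0 <= delta * (1 - \prod_(s <- children T) V s).
  have /andP[w0 w1] := weight01; rewrite /a; set X := \prod_(_ <- _) _ => H.
  have := mulr_ge0 w0 H; lra.
have sT s : s \in children T -> (size (vertices s) < size (vertices T))%N.
  by case: (T) => ? ?; exact: size_vertices_child.
case: (leP 0 delta) => [d0|/ltW d0].
  rewrite mulr_ge0// subr_ge0; apply: prodr_le1 => s /sT sV.
  by rewrite V0; exact: (tilt_trunc n sV).1.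
rewrite mulr_le0// ?subr_le0; apply: prodr_ge1 => s /sT sV.
exact: (tilt_trunc n sV).2.
Qed.
End Supermartingale.

(** * Laws of discrete random variables and of Galton-Watson trees *)

Section DiscreteVariables.
Context {R : realType} {d : measure_display} {W : measurableType d}.
Variable P : probability W R.

Lemma fine_probK (A : set W) : measurable A -> (fine (P A))%:E = P A.
Proof. by move=> mA; rewrite fineK// fin_num_measure. Qed.

Lemma probability_ae_eq (A B : set W) : measurable A -> measurable B ->
  {ae P, forall w, A w <-> B w} -> P A = P B.
Proof.
move=> mA mB [N [mN N0 ABN]].
have H A' B' : measurable A' -> measurable B' -> (forall w, ~ N w -> A' w -> B' w) ->
    (P A' <= P B')%E.
  move=> mA' mB' AB'; rewrite -[leRHS]adde0 -N0.
  apply: le_trans (measureU2 _ _ _) => //; apply: le_measure; rewrite ?inE//.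
    exact: measurableU.
  by move=> w A'w; have [Nw|/AB'] := pselect (N w); [right|left; auto].
have NAB w : ~ N w -> (A w <-> B w).
  by move=> Nw; apply: contrapT => nAB; apply/Nw/ABN.
by apply/eqP; rewrite eq_le !H// => w /NAB[].
Qed.

Section OneVariable.
Variables (S : countType) (X : W -> S).
Hypothesis mX : discrete_rv X.

Lemma discrete_rv_sum (L : seq S) : uniq L ->
  (\sum_(x <- L) P (X @^-1` [set x]))%E = P (X @^-1` [set x | x \in L]).
Proof.
elim: L => [|x L IH] /=; first rewrite big_nil.
  by rewrite (_ : _ @^-1` _ = set0) ?measure0//; apply/seteqP; split.
move=> /andP[xL uL]; rewrite big_cons IH// -measureU; [|exact: mX|exact: mX|].
  congr (P _); apply/seteqP; split=> w /=; rewrite inE.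
    by case=> [->|->]; rewrite ?eqxx ?orbT.
  by case/orP => [/eqP|]; [left|right].
by apply/seteqP; split=> w //= [-> /=]; rewrite (negbTE xL).
Qed.

Lemma fine_discrete_rv_sum_le1 (L : seq S) : uniq L ->
  \sum_(x <- L) fine (P (X @^-1` [set x])) <= 1.
Proof.
move=> uL; rewrite -lee_fin -sumEFin.
under eq_bigr do rewrite fine_probK//.
by rewrite discrete_rv_sum// probability_le1//; exact: mX.
Qed.

Lemma discrete_rv_series (A : set S) : P (X @^-1` A) =
  (\sum_(n <oo) P (X @^-1` [set x | pickle_inv n = Some x /\ A x]))%E.
Proof.
rewrite -measure_semi_bigcup.
- congr (P _); apply/seteqP; split=> w /=; last by move=> [n _ []].
  by move=> Aw; exists (choice.pickle (X w)) => //=; rewrite pickleK_inv.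
- by move=> n; exact: mX.
- move=> m n _ _ [w [/= [mx _] [nx _]]].
  have := @pickle_invK S m; have := @pickle_invK S n.
  by rewrite mx nx /= => -> ->.
- rewrite (_ : \bigcup_n _ = X @^-1` \bigcup_n [set x | pickle_inv n = Some x /\ A x]).
    exact: mX.
  by rewrite preimage_bigcup.
Qed.

(** The bridge from finite lists to events: the enumeration of the countable type writes the
    probability as a series, whose partial sums are sums over finite lists. *)
Lemma discrete_rv_le (A : set S) (r : R) :
  (forall L, uniq L -> (forall x, x \in L -> A x) ->
     \sum_(x <- L) fine (P (X @^-1` [set x])) <= r) ->
  (P (X @^-1` A) <= r%:E)%E.
Proof.
move=> H; rewrite discrete_rv_series; apply: lime_le.
  by apply: is_cvg_nneseries => n _ _; exact: measure_ge0.
apply: nearW => N.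
pose L := [seq x <- pmap (@pickle_inv S) (iota 0 N) | `[< A x >]].
have uL : uniq L by apply/filter_uniq/(pmap_uniq (@pickle_invK S))/iota_uniq.
apply: le_trans (_ : (\sum_(x <- L) fine (P (X @^-1` [set x])))%:E <= _)%E; last first.
  by rewrite lee_fin H// => x; rewrite mem_filter => /andP[/asboolP].
rewrite -sumEFin big_filter [leRHS]big_mkcond big_pmap /index_iota subn0.
apply: lee_sum => n _; case E : (pickle_inv n) => [x|] /=.
  case: asboolP => Ax; first rewrite fine_probK//.
    by apply: le_measure; rewrite ?inE; [exact: mX..|move=> w /= [[->]]].
  rewrite (_ : _ @^-1` _ = set0) ?measure0//.
  by apply/seteqP; split=> w //= [[xw]]; rewrite -xw.
by rewrite (_ : _ @^-1` _ = set0) ?measure0//; apply/seteqP; split=> w //= [].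
Qed.

Lemma discrete_rv_ae : {ae P, forall w, (0 < P (X @^-1` [set X w]))%E}.
Proof.
exists (X @^-1` [set x | P (X @^-1` [set x]) = 0%E]); split.
- exact: mX.
- apply/eqP; rewrite -measure_le0 discrete_rv_le// => L uL L0.
  by rewrite big_seq big1// => x /L0 /= ->.
- by move=> w /= /negP; rewrite lt0e measure_ge0 andbT negbK => /eqP.
Qed.
End OneVariable.

Lemma independent_seq (I : choiceType) (S : I -> countType) (X : forall i, W -> S i) :
  mutually_independent P X -> forall (L : seq I) (A : forall i, set (S i)), uniq L ->
  fine (P [set w | forall i, i \in L -> A i (X i w)]) =
  \prod_(i <- L) fine (P (X i @^-1` A i)).
Proof.
move=> iX L A uL; have JL : [fset i in L]%fset =i L by move=> i; rewrite inE.
rewrite -(perm_big _ (uniq_perm (fset_uniq _) uL JL)) /= -iX.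
congr (fine (P _)); apply/seteqP; split=> w /= H i; first by rewrite /= JL; exact: H.
by rewrite -JL; exact: H.
Qed.

End DiscreteVariables.

Lemma measurable_forall_in d (W : measurableType d) (I : eqType) (L : seq I)
    (A : I -> set W) : (forall i, i \in L -> measurable (A i)) ->
  measurable [set w | forall i, i \in L -> A i w].
Proof.
elim: L => [|i L IH] mA.
  by rewrite (_ : [set _ | _] = setT)//; apply/seteqP; split=> w.
rewrite (_ : [set _ | _] = A i `&` [set w | forall i, i \in L -> A i w]).
  apply: measurableI; first by apply: mA; rewrite inE eqxx.
  by apply: IH => j jL; apply: mA; rewrite inE jL orbT.
apply/seteqP; split=> w /=.
  by move=> H; split=> [|j jL]; apply: H; rewrite inE ?eqxx// jL orbT.
by move=> [Ai H] j; rewrite inE => /orP[/eqP->//|/H].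
Qed.

Lemma discrete_rv_cst d (W : measurableType d) (S : countType) (c : S) :
  discrete_rv (cst c : W -> S).
Proof. by move=> A; rewrite preimage_cst; case: ifP. Qed.
Arguments discrete_rv_cst {d W S}.

(** The family [X] is general in the induction, since the subtree at the [k]-th child reads the
    words at the addresses [k :: u]. *)
Lemma tree_eq_offspring (G : countType) (X : seq nat * G -> seq G) (t t' : tree G) :
  ttype t' = ttype t ->
  (forall u s, subtree t u = Some s -> X (u, ttype s) = map (@ttype G) (children s)) ->
  (forall u s, subtree t' u = Some s -> X (u, ttype s) = map (@ttype G) (children s)) ->
  t' = t.
Proof.
elim/tree_nested_ind: t X t' => i ts IH X [i' ts'] /= i'i Ht Ht'.
have /= E := Ht [::] _ erefl; have /= := Ht' [::] _ erefl; rewrite i'i E => mE.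
have sz : size ts' = size ts by rewrite -(size_map (@ttype G) ts) mE size_map.
congr Node; set d := Node i [::]; apply: (@eq_from_nth _ d) => // k; rewrite sz => kts.
apply: (IH _ _ (fun ui => X (k :: ui.1, ui.2))); first exact: mem_nth.
- by rewrite -(nth_map d (ttype d)) ?sz// -mE (nth_map d).
- by move=> u s us; apply: (Ht (k :: u)); rewrite subtree_cons (onth_lt d).
- by move=> u s us; apply: (Ht' (k :: u)); rewrite subtree_cons (onth_lt d) ?sz.
Qed.

(** * Laws of the full and of the stopped Galton-Watson tree *)

Section GaltonWatsonLaw.
Context {R : realType} {G : countType} {d : measure_display} {W : measurableType d}.
Variables (P : probability W R) (sigma : G -> W -> seq G) (alpha : W -> G)
  (xi : seq nat * G -> W -> seq G).
Hypothesis Hxi : offspring_family P sigma alpha xi.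
Implicit Types (t s : tree G) (u : seq nat).

Definition offspring_law i w : R := fine (P (sigma i @^-1` [set w])).

Lemma offspring_law_ge0 i w : 0 <= offspring_law i w.
Proof. exact/fine_ge0/measure_ge0. Qed.

Lemma offspring_law_mass i (A : seq (seq G)) : uniq A ->
  \sum_(w <- A) offspring_law i w <= 1.
Proof. by case: Hxi => ms _ _ _ _; exact: fine_discrete_rv_sum_le1. Qed.

(** The predicate [a] selects the vertices whose word is constrained; for the stopped tree it leaves
    out the non-root vertices of type [kappa]. *)
Definition offspring_event (X : seq nat * G -> W -> seq G) (a : pred (seq nat)) t :=
  [set w | forall u s, a u -> subtree t u = Some s ->
     X (u, ttype s) w = map (@ttype G) (children s)].

Lemma measurable_offspring_event X a t :
  (forall ui, discrete_rv (X ui)) -> measurable (offspring_event X a t).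
Proof.
move=> mX; rewrite (_ : offspring_event _ _ _ = [set w | forall u,
    u \in [seq u <- vertices t | a u] -> [set w | forall s, subtree t u = Some s ->
    X (u, ttype s) w = map (@ttype G) (children s)] w]).
  apply: measurable_forall_in => u _; case: (subtree t u) => [s|].
    rewrite [X in measurable X](_ : _ = X (u, ttype s) @^-1` [set map (@ttype G) (children s)]).
      exact: mX.
    by apply/seteqP; split=> w /=; [apply|move=> ? ? [<-]].
  by rewrite [X in measurable X](_ : _ = setT)//; apply/seteqP; split.
apply/seteqP; split=> w /= H u.
  by rewrite mem_filter => /andP[au _] s; exact: H.
move=> s au us; apply: H => //; by rewrite mem_filter au mem_vertices us.
Qed.

Definition source_value t (k : option (seq nat * G)) : set (source_type k) :=
  match k return set (source_type k) with
  | Some ui => [set if subtree t ui.1 is Some s then map (@ttype G) (children s) else [::]]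
  | None => [set ttype t]
  end.

(** Distinct vertices read distinct sources, so independence yields a product. The boolean tells
    whether the random root type is one more source, or the root type is constant. *)
Lemma offspring_event_law (b : bool) a t :
  fine (P ([set w | b -> alpha w = ttype t] `&` offspring_event xi a t)) =
  (if b then fine (P (alpha @^-1` [set ttype t])) else 1) *
  \prod_(u <- vertices t | a u) offspring_weight offspring_law (subtree t u).
Proof.
have [_ _ [malpha mxi] ind same] := Hxi.
pose key u : option (seq nat * G) := Some (u, ttype (odflt t (subtree t u))).
have key_inj : injective key by move=> u u' [].
pose L := (if b then [:: None] else [::]) ++ [seq key u | u <- vertices t & a u].
have uL : uniq L.
  rewrite cat_uniq map_inj_uniq//= filter_uniq ?vertices_uniq// andbT.
  apply/andP; split; first by case: b {L}.
  by apply/hasPn => _ /mapP[u _ ->]; case: b {L}.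
have := independent_seq ind (source_value t) uL.
rewrite big_cat big_map big_filter /= => H; transitivity (fine (P
  [set w | forall k, k \in L -> source_value t (source alpha xi k w)])).
  congr (fine (P _)); apply/seteqP; split=> w /=.
    move=> [wb wa] k; rewrite mem_cat => /orP[|/mapP[u]].
      by case: (b) wb => // wb; rewrite inE => /eqP-> /=; exact: wb.
    rewrite mem_filter mem_vertices => /andP[au tu] -> /=.
    by case E : (subtree t u) tu => [s|//] _ /=; apply: wa.
  move=> wL; split=> [bT|u s au us].
    by have := wL None; rewrite /L bT inE eqxx => /(_ isT).
  have : key u \in L.
    by rewrite mem_cat mem_map// mem_filter au mem_vertices us orbT.
  by move=> /wL; rewrite /key us /= us.
rewrite H; congr (_ * _); first by case: (b); rewrite ?big_seq1 ?big_nil.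
rewrite big_seq_cond [RHS]big_seq_cond; apply: eq_bigr => u /andP[].
rewrite mem_vertices /=; case: (subtree t u) => [s|//] _ _ /=.
by rewrite same.
Qed.

Lemma galton_watson_event alpha' X T t : discrete_rv alpha' ->
  (forall ui, discrete_rv (X ui)) -> galton_watson P alpha' X T ->
  P (T @^-1` [set t]) =
  P (alpha' @^-1` [set ttype t] `&` offspring_event X predT t).
Proof.
move=> ma mX [mT HT]; apply: probability_ae_eq; first exact: (mT [set t]).
  by apply: measurableI; [exact: ma|exact: measurable_offspring_event].
apply: filterS HT => w [Tr To]; split=> /= [TE|[ra oa]].
  by split=> [|u s _ us]; [rewrite -Tr TE|rewrite -(To u s)// TE].
apply: (tree_eq_offspring (X := X^~ w)); first by rewrite Tr.
- by move=> u s us; exact: oa.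
- by move=> u s /To ->.
Qed.

Lemma galton_watson_law T t : galton_watson P alpha xi T ->
  fine (P (T @^-1` [set t])) =
  fine (P (alpha @^-1` [set ttype t])) * tree_weight offspring_law t.
Proof.
move=> HT; have [_ _ [malpha mxi] _ _] := Hxi.
rewrite (galton_watson_event t malpha mxi HT) -(offspring_event_law true predT).
by congr (fine (P (_ `&` _))); apply/seteqP; split=> w /=; [move=> + _|apply].
Qed.

Lemma galton_watson_cst_law kappa T t : galton_watson P (cst kappa) xi T ->
  fine (P (T @^-1` [set t])) =
  if ttype t == kappa then tree_weight offspring_law t else 0.
Proof.
move=> HT; have [_ _ [malpha mxi] _ _] := Hxi.
rewrite (galton_watson_event t (discrete_rv_cst kappa) mxi HT); case: eqP => tk.
  rewrite -[RHS]mul1r -(offspring_event_law false predT).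
  by congr (fine (P (_ `&` _))); apply/seteqP; split=> w //= _.
rewrite (_ : _ `&` _ = set0) ?measure0//.
by apply/seteqP; split=> w //= [/esym].
Qed.

Section Stopped.
Variables (kappa : G) (Ts : W -> tree G).
Hypothesis HTs : galton_watson P (cst kappa) (stopped kappa xi) Ts.

Let stop t u := (u == [::]) || (vtype t u != Some kappa).

Lemma stopped_discrete ui : discrete_rv (stopped kappa xi ui).
Proof.
have [_ _ [_ mxi] _ _] := Hxi; rewrite /stopped; case: ifP => _; last exact: mxi.
exact: discrete_rv_cst.
Qed.

Let stopped_event t : fine (P (Ts @^-1` [set t])) =
  fine (P (cst kappa @^-1` [set ttype t] `&` offspring_event (stopped kappa xi) predT t)).
Proof.
by rewrite (galton_watson_event t (discrete_rv_cst kappa) stopped_discrete HTs).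
Qed.

Lemma stopped_tree_law t : ttype t = kappa ->
  (forall u, u \in leaves kappa t -> subtree t u = Some (Node kappa [::])) ->
  fine (P (Ts @^-1` [set t])) = stopped_weight offspring_law kappa t.
Proof.
move=> tk tl; rewrite stopped_event -[RHS]mul1r -(offspring_event_law false (stop t)).
congr (fine (P _)); apply/seteqP; split=> w /= [_ H]; split=> // u s tu us.
  have := H u s isT us; rewrite /stopped /= ifN// negb_and negbK.
  by move: tu; rewrite /stop /vtype us.
rewrite /stopped /=; case: ifP => [uk|/negbT uk]; last first.
  by apply: H => //; move: uk; rewrite /stop /vtype us negb_and negbK.
have := tl u; rewrite mem_leaves /vtype us => /(_ uk) [->].
by [].
Qed.

Lemma stopped_tree_support t : (0 < P (Ts @^-1` [set t]))%E ->
  ttype t = kappa /\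
  forall u, u \in leaves kappa t -> subtree t u = Some (Node kappa [::]).
Proof.
move=> P0; have {}P0 : fine (P (Ts @^-1` [set t])) != 0.
  rewrite gt_eqF// fine_gt0// P0 /= ltey_eq fin_num_measure//; exact: (HTs.1).
have [w [/= kt wE]] : exists w, (cst kappa @^-1` [set ttype t] `&`
    offspring_event (stopped kappa xi) predT t) w.
  apply/set0P; apply: contra_neq P0 => E.
  by rewrite stopped_event E measure0.
split=> [|u]; first exact/esym.
rewrite mem_leaves => /andP[u0]; rewrite /vtype.
case E : (subtree t u) => [[i ts]|//] /eqP[/= ik].
have := wE u _ isT E; rewrite /stopped /= u0 ik eqxx /= => /esym.
by move/(congr1 size)/eqP; rewrite size_map size_eq0 => /eqP ->.
Qed.
End Stopped.
End GaltonWatsonLaw.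

(** The bound ln (1 + y) <= y at y = - x / (1 + x) gives ln (1 + x) >= x / (1 + x), and x / (1 + x)
    >= x - 2 x^2 as soon as x >= -1/2. *)
Lemma ln_ge_quadratic (R : realType) (x : R) : `|x| <= 2^-1 -> x - 2 * x ^+ 2 <= ln (1 + x).
Proof.
rewrite ler_norml => /andP[x1 x2].
have x0 : 0 < 1 + x by lra.
have : ln (1 + (- x / (1 + x))) <= - x / (1 + x).
  apply: le_ln1Dx; rewrite mulNr ltrN2 ltr_pdivrMr// mul1r; lra.
have -> : 1 + (- x / (1 + x)) = (1 + x)^-1 by field; rewrite gt_eqF.
rewrite lnV ?posrE// lerNl mulNr opprK => /(le_trans _); apply.
rewrite ler_pdivlMr//; nra.
Qed.

(** * Exponential tail of the number of fringe occurrences *)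

Section Tail.
Context {R : realType} {G : countType} {d : measure_display} {W : measurableType d}.
Variables (P : probability W R) (sigma : G -> W -> seq G) (alpha : W -> G)
  (xi : seq nat * G -> W -> seq G) (T : W -> tree G) (kappa : G).
Hypotheses (Hxi : offspring_family P sigma alpha xi) (HT : galton_watson P alpha xi T).
Variable (t0 : tree G).
Hypothesis t0k : ttype t0 = kappa.

Local Notation q := (offspring_law P sigma).
Local Notation w0 := (tree_weight q t0).
Local Notation Nk t := ((nb_type kappa t)%:R : R).
Local Notation N0 t := ((occurrences t0 t)%:R : R).

Let tilt delta := tilt_factor q kappa t0 delta.
Let la delta := ln (1 - delta * w0).
Let lb delta := ln (1 + delta * (1 - w0)).

Let w01 : 0 <= w0 <= 1 := weight01 (offspring_law_ge0 P sigma) (offspring_law_mass Hxi) t0.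

Lemma fringe_prod_tiltE delta t : `|delta| < 1 ->
  fringe_prod (tilt delta) t = expR (Nk t * la delta + N0 t * (lb delta - la delta)).
Proof.
move=> d1; elim/tree_nested_ind: t => i ts IH.
rewrite fringe_prodE nb_typeE occurrencesE !natrD !natr_sum !mulrDl !mulr_suml.
rewrite addrACA -big_split expRD expR_sum; congr (_ * _).
  have a0 := tilt_a_gt0 (offspring_law_ge0 P sigma) (offspring_law_mass Hxi) t0 d1.
  have b0 := tilt_b_gt0 (offspring_law_ge0 P sigma) (offspring_law_mass Hxi) t0 d1.
  rewrite /tilt /tilt_factor.
  case: eqP => [tE|_] /=; last first.
    case: eqP => _ /=; rewrite ?mul0r ?addr0 ?expR0 ?mul1r// lnK//.
  have -> : i == kappa by apply/eqP; rewrite -t0k -tE.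
  by rewrite !mul1r addrC subrK lnK.
by rewrite big_seq [RHS]big_seq; apply: eq_bigr => s /IH.
Qed.

(** The bit [b] is the side of the deviation, and [delta] takes its sign. With A and B the
    logarithms of the two weights, the exponent is recentred as Nk ((1 - w0) A + w0 B) + (N0 - w0
    Nk) (B - A). In the first term the linear parts cancel, leaving a loss of at most 2 eta^2 per
    vertex; in the second, B - A is at least eta - 2 eta^2 in the direction of the deviation. *)
Lemma fringe_prod_tilt_ge (b : bool) (eps eta : R) t : 0 < eps -> 0 < eta -> eta <= 2^-1 ->
  eps * Nk t <= (-1) ^+ b * (N0 t - w0 * Nk t) ->
  expR ((eps * (eta - 2 * eta ^+ 2) - 2 * eta ^+ 2) * Nk t) <=
  fringe_prod (tilt ((-1) ^+ b * eta)) t.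
Proof.
move=> eps0 eta0 eta1 H; have /andP[v0 v1] := w01.
have [delta deltaE] : exists delta, delta = (-1) ^+ b * eta by exists ((-1) ^+ b * eta).
rewrite -deltaE; have dn : `|delta| = eta.
  by rewrite deltaE normrM normrX normrN normr1 expr1n mul1r gtr0_norm.
rewrite fringe_prod_tiltE ?dn; last lra.
rewrite ler_expR; set A := la delta; set B := lb delta.
have N0k : 0 <= Nk t by [].
have aN : `|- (delta * w0)| = eta * w0 by rewrite normrN normrM dn (ger0_norm v0).
have bN : `|delta * (1 - w0)| = eta * (1 - w0).
  by rewrite normrM dn ger0_norm// subr_ge0.
have A1 : - (delta * w0) - 2 * (delta * w0) ^+ 2 <= A.
  by rewrite -[X in _ - _ * X]sqrrN; apply: ln_ge_quadratic; rewrite aN; nra.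
have B1 : delta * (1 - w0) - 2 * (delta * (1 - w0)) ^+ 2 <= B.
  by apply: ln_ge_quadratic; rewrite bN; nra.
have A2 : A <= - (delta * w0).
  by apply: le_ln1Dx; have := ler_norm (delta * w0); rewrite -normrN aN; nra.
have B2 : B <= delta * (1 - w0).
  apply: le_ln1Dx; have := ler_norm (- (delta * (1 - w0))); rewrite normrN bN; nra.
have d2 : delta ^+ 2 = eta ^+ 2 by rewrite -dn real_normK ?num_real.
have mean : - (2 * eta ^+ 2) <= (1 - w0) * A + w0 * B.
  move: A1 B1; rewrite !exprMn d2; set D := eta ^+ 2 => A1 B1.
  have D0 : 0 <= D by exact: sqr_ge0.
  nra.
have slope : eta - 2 * eta ^+ 2 <= (-1) ^+ b * (B - A).
  move: A1 B1; rewrite !exprMn d2; set D := eta ^+ 2 => A1 B1.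
  have D0 : 0 <= D by exact: sqr_ge0.
  move: A1 A2 B1 B2; rewrite deltaE; case: (b); rewrite ?expr1 ?expr0 => A1 A2 B1 B2; nra.
have slope0 : 0 <= eta - 2 * eta ^+ 2 by nra.
have -> : Nk t * A + N0 t * (B - A) =
    Nk t * ((1 - w0) * A + w0 * B) + (N0 t - w0 * Nk t) * (B - A) by ring.
have -> : (N0 t - w0 * Nk t) * (B - A) =
   ((-1) ^+ b * (N0 t - w0 * Nk t)) * ((-1) ^+ b * (B - A)).
  by case: (b); rewrite ?expr1 ?expr0; ring.
have := ler_pM (mulr_ge0 (ltW eps0) N0k) slope0 H slope.
have := ler_wpM2l N0k mean.
lra.
Qed.

(** The list is split by root type: within one type [submass_tilt] applies, and the masses of the
    root types add up to at most 1. *)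
Lemma sum_fringe_prod_le1 delta (L : seq (tree G)) : `|delta| < 1 -> uniq L ->
  \sum_(t <- L) fine (P (T @^-1` [set t])) * fringe_prod (tilt delta) t <= 1.
Proof.
move=> d1 uL; have [_ _ [malpha _] _ _] := Hxi.
rewrite (sum_partition (@ttype G)).
apply: le_trans (_ : _ <= _)
  (fine_discrete_rv_sum_le1 P malpha (undup_uniq (map (@ttype G) L))).
apply: ler_sum => i _.
under eq_bigr => t /eqP ti do rewrite (galton_watson_law Hxi t HT) ti -mulrA.
rewrite -mulr_sumr ler_piMr ?fine_ge0//.
exact: (submass_tilt (offspring_law_ge0 P sigma) (offspring_law_mass Hxi) t0k d1).
Qed.

Lemma occurrences_tail (eps : R) : 0 < eps -> exists2 c : R, 0 < c &
  forall s : R,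
    fine (P [set w | s <= Nk (T w) /\ eps * Nk (T w) < `|N0 (T w) - w0 * Nk (T w)|])
    <= 2 * expR (- c * s).
Proof.
(* With this choice eta (eps + 1) = eps / 4, so the rate c = eta (eps - 2 eta (eps + 1)) equals eta
   eps / 2. *)
move=> eps0; set eta := eps / (4 * (eps + 1)).
have eta0 : 0 < eta by rewrite divr_gt0// mulr_gt0// addr_gt0.
have etaE : eta * (eps + 1) = eps / 4 by rewrite /eta; field; rewrite gt_eqF// addr_gt0.
have eta1 : eta <= 2^-1 by nra.
set c := eps * (eta - 2 * eta ^+ 2) - 2 * eta ^+ 2.
have c0 : 0 < c.
  have -> : c = eta * (eps - 2 * (eta * (eps + 1))) by rewrite /c; ring.
  by rewrite etaE mulr_gt0//; lra.
exists c => // s.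
pose side (b : bool) := [set t | s <= Nk t /\
  eps * Nk t <= (-1) ^+ b * (N0 t - w0 * Nk t)].
(* Markov's inequality on finite lists: for trees in [side b], the tilted product times
   [expR (- c * s)] is at least 1. *)
have one b : (P (T @^-1` side b) <= (expR (- c * s))%:E)%E.
  apply: (discrete_rv_le HT.1) => L uL LA.
  have d1 : `|(-1) ^+ b * eta| < 1.
    by rewrite normrM normrX normrN normr1 expr1n mul1r gtr0_norm//; lra.
  apply: (@le_trans _ _ (expR (- c * s) *
      \sum_(t <- L) fine (P (T @^-1` [set t])) * fringe_prod (tilt ((-1) ^+ b * eta)) t)).
    rewrite mulr_sumr !big_seq; apply: ler_sum => t /LA [st Ht].
    rewrite mulrCA ler_peMr ?fine_ge0//.
    apply: le_trans (ler_wpM2l (expR_ge0 _) (fringe_prod_tilt_ge eps0 eta0 eta1 Ht)).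
    rewrite -/c -expRD -[leLHS]expR0 ler_expR; nra.
  by rewrite ler_piMr ?expR_ge0//; exact: sum_fringe_prod_le1.
have mT A : measurable (T @^-1` A) by exact: HT.1.
rewrite -lee_fin fine_probK; last first.
  exact: (mT [set t | s <= Nk t /\ eps * Nk t < `|N0 t - w0 * Nk t|]).
apply: (@le_trans _ _ (P (T @^-1` side false `|` T @^-1` side true))).
  apply: le_measure; rewrite ?inE.
  - exact: (mT [set t | s <= Nk t /\ eps * Nk t < `|N0 t - w0 * Nk t|]).
  - by apply: measurableU; exact: mT.
  - move=> w /= [sw]; rewrite ltr_normr => /orP[/ltW H|/ltW H]; [left|right].
      by split=> //=; rewrite expr0 mul1r.
    by split=> //=; rewrite expr1 mulN1r.
apply: le_trans (measureU2 _ _ _) _; try exact: mT.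
by rewrite mulr_natl mulr2n EFinD leeD ?one.
Qed.
End Tail.

(** * The limit tree *)

Section MeanMarks.
Context {R : realType} {G : countType} {d : measure_display} {W : measurableType d}.
Variables (P : probability W R) (X : W -> tree G).
Hypothesis mX : discrete_rv X.

Lemma discrete_rv_measurable_fun (f : tree G -> \bar R) :
  measurable_fun setT (f \o X).
Proof. by move=> _ B _; rewrite setTI; exact: (mX (f @^-1` B)). Qed.

(** It has at most one element, the tree underlying the [n]-th marked tree if that one lies in [A].
    Summing its indicator over [n] counts the markings of a tree that belong to [A]. *)
Definition marked_at (A : set (mtree G)) n : set (tree G) :=
  [set t | exists p, [/\ pickle_inv n = Some p, A p & (val p).1 = t]].

Lemma markings_uniq (t : tree G) : uniq (markings t).
Proof.
apply: pmap_sub_uniq; rewrite map_inj_uniq ?vertices_uniq//.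
by move=> u v [].
Qed.

Lemma markingsP (t : tree G) (p : mtree G) : (p \in markings t) = ((val p).1 == t).
Proof.
rewrite mem_pmap_sub; apply/mapP/eqP => [[u _ -> //]|<-].
exists (val p).2; last exact: surjective_pairing.
by rewrite mem_vertices; exact: (valP p).
Qed.

Lemma count_markings_le (A : set (mtree G)) (t : tree G) :
  ((count (fun p => `[< A p >]) (markings t))%:R%:E <=
   \sum_(n <oo) (\1_(marked_at A n) t : R)%:E)%E.
Proof.
set L := [seq p <- markings t | `[< A p >]].
set N := (\sum_(p <- L) (choice.pickle p).+1)%N.
apply: le_trans (nneseries_lim_ge N _) => //.
rewrite sumEFin lee_fin -size_filter -/L /index_iota subn0.
have uL : uniq (map (@choice.pickle (mtree G)) L).
  rewrite map_inj_uniq; last exact: (pcan_inj (@choice.pickleK _)).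
  exact/filter_uniq/markings_uniq.
rewrite (_ : (size L)%:R = \sum_(n <- map (@choice.pickle _) L) \1_(marked_at A n) t :> R).
  apply: sum_uniq_sub => // [|n /mapP[p pL ->]]; first exact: iota_uniq.
  rewrite mem_iota /= add0n /N.
  by rewrite (big_rem p)// leq_addr.
rewrite big_map (eq_big_seq (fun=> 1)) => [|p].
  by rewrite -sum1_size natr_sum.
rewrite mem_filter markingsP => /andP[/asboolP Ap /eqP pt].
by rewrite indicE mem_set//; exists p; rewrite pickleK_inv.
Qed.

Lemma mean_markings_le (A : set (mtree G)) :
  ('E_P[fun w => (count (fun p => `[< A p >]) (markings (X w)))%:R] <=
   \sum_(n <oo) P (X @^-1` marked_at A n))%E.
Proof.
have -> : (\sum_(n <oo) P (X @^-1` marked_at A n) =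
    \sum_(n <oo) \int[P]_w (\1_(marked_at A n) (X w) : R)%:E)%E.
  by apply: eq_eseriesr => n _; rewrite -[Z in P Z]setIT -integral_indic//.
rewrite -integral_nneseries//; last first.
  move=> n; exact: (discrete_rv_measurable_fun (fun t => (\1_(marked_at A n) t : R)%:E)).
rewrite unlock; apply: ge0_le_integral => //.
- exact: (discrete_rv_measurable_fun (fun t =>
    ((count (fun p => `[< A p >]) (markings t))%:R : R)%:E)).
- exact: (discrete_rv_measurable_fun (fun t =>
    (\sum_(n <oo) (\1_(marked_at A n) t : R)%:E)%E)).
- by move=> w _; exact: count_markings_le.
Qed.

Lemma mean_nbE i :
  (mean_nb P i X =
  'E_P[fun w => (count (fun p => `[< mark_type p = Some i >]) (markings (X w)))%:R])%E.
Proof.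
rewrite /mean_nb; congr expectation; apply/funext => w.
congr (_%:R); transitivity (count (fun p => mark_type p == Some i) (markings (X w))).
  by symmetry; exact: (count_markings (fun q => vtype q.1 q.2 == Some i)).
by apply: eq_count => p; apply/eqP/asboolP.
Qed.

(** The root accounts for at most one vertex. With mean 2, at least mean 1 is left for the non-root
    vertices, which are the possible marks of a spine block. *)
Lemma mean_nb_le1 i : (mean_nb P i X <=
  1 + 'E_P[fun w => (count (fun p => `[< mark_type p = Some i /\ (val p).2 <> [::] >])
    (markings (X w)))%:R])%E.
Proof.
rewrite mean_nbE unlock -[Z in (Z + _)%E](probability_setT P) -[Z in P Z]setIT.
rewrite -integral_indic// -ge0_integralD//; last 2 first.
- exact: (discrete_rv_measurable_fun (fun t => (\1_setT t : R)%:E)).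
- exact: (discrete_rv_measurable_fun (fun t => ((count (fun p =>
    `[< mark_type p = Some i /\ (val p).2 <> [::] >]) (markings t))%:R : R)%:E)).
apply: ge0_le_integral => //.
- exact: (discrete_rv_measurable_fun (fun t =>
    ((count (fun p => `[< mark_type p = Some i >]) (markings t))%:R : R)%:E)).
- exact: (discrete_rv_measurable_fun (fun t => ((\1_(@setT (tree G)) t : R)%:E +
    ((count (fun p => `[< mark_type p = Some i /\ (val p).2 <> [::] >])
      (markings t))%:R : R)%:E)%E)).
move=> w _; rewrite indicT -EFinD lee_fin nat1r ler_nat.
set a := fun p => _; set b := fun p => _.
apply: leq_trans (_ : count (predU b (fun p => (val p).2 == [::])) (markings (X w)) <= _)%N.
  apply: sub_count => p /asboolP ap /=; apply/orP.
  by case: (eqVneq (val p).2 [::]) => [|/eqP pn]; [right|left; apply/asboolP].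
have root1 : (count (fun p : mtree G => (val p).2 == [::]) (markings (X w)) <= 1)%N.
  rewrite (count_markings (fun q => q.2 == [::])) (count_uniq_mem _ (vertices_uniq _)).
  exact: leq_b1.
have := count_predUI b (fun p => (val p).2 == [::]) (markings (X w)); lia.
Qed.
End MeanMarks.

(** * Deterministic description of the spine *)

Section Spine.
Variables (G : countType) (kappa gamma : G).
Hypothesis Hgamma : gamma != kappa.
Implicit Types (p : mtree G) (t : tree G).

Definition stopped_tree t := ttype t = kappa /\
  forall u, u \in leaves kappa t -> subtree t u = Some (Node kappa [::]).

Lemma stopped_tree_cut t : ttype t = kappa -> stopped_tree (cut kappa t).
Proof.
by move=> tk; split=> // u; rewrite mem_leaves => /andP[u0 /eqP]; exact: cut_leaf.
Qed.

Variables (b : nat -> mtree G) (r : nat -> seq nat -> tree G).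

Definition proper_parts := [/\ mark_type (b 0%N) = Some gamma /\ stopped_tree (val (b 0%N)).1,
  forall i, [/\ mark_type (b i.+1) = Some kappa, (val (b i.+1)).2 <> [::] &
    stopped_tree (val (b i.+1)).1] &
  forall i u, ttype (r i u) = kappa].
Hypothesis br : proper_parts.

Lemma ttype_block p r0 top : ttype (block kappa p r0 top) = ttype (val p).1.
Proof. by rewrite /block; case: (val p) => -[i ts] v. Qed.

Lemma ttype_spine h : ttype (spine kappa b r h).1 = kappa.
Proof.
have [[_ [b0 _]] bS _] := br; case: h => [|h] /=; first by rewrite ttype_block.
by case: (spine _ b r h) => t v /=; rewrite ttype_block; have [_ _ []] := bS h.
Qed.

Lemma spineS h : spine kappa b r h.+1 =
  (block kappa (b h.+1) (r h.+1) (Some (spine kappa b r h).1),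
   (val (b h.+1)).2 ++ (spine kappa b r h).2).
Proof. by rewrite /=; case: (spine _ b r h). Qed.

(** Because [gamma] differs from [kappa], the mark of block 0 is not a grafting place, and the value
    [None] given to [block] as its top is never read. *)
Lemma mark0_leaf : (val (b 0%N)).2 \notin leaves kappa (val (b 0%N)).1.
Proof.
have [[b0 _] _ _] := br; rewrite mem_leaves negb_and; apply/orP; right.
by rewrite -/(mark_type _) b0; apply: contra Hgamma => /eqP[->].
Qed.

Lemma markS_leaf i : (val (b i.+1)).2 \in leaves kappa (val (b i.+1)).1.
Proof.
have [_ bS _] := br; have [bk bn _] := bS i.
by rewrite mem_leaves -/(mark_type _) bk eqxx andbT; exact/eqP.
Qed.

Lemma block0P T : block kappa (b 0%N) (r 0%N) None = T <->
  (val (b 0%N)).1 = cut kappa T /\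
  forall u, u \in leaves kappa (val (b 0%N)).1 -> Some (r 0%N u) = subtree T u.
Proof.
have [[_ [_ b0]] _ rk] := br; have vl := mark0_leaf.
rewrite blockP//; last by rewrite (negbTE vl).
split=> -[E H]; split=> // u ul; have := H u ul; rewrite ifN//;
  by apply: contraNneq vl => <-.
Qed.

Lemma blockSP i t T : ttype t = kappa ->
  block kappa (b i.+1) (r i.+1) (Some t) = T <->
  (val (b i.+1)).1 = cut kappa T /\
  forall u, u \in leaves kappa (val (b i.+1)).1 ->
    (if u == (val (b i.+1)).2 then Some t else Some (r i.+1 u)) = subtree T u.
Proof.
move=> tk; have [_ bS rk] := br; have [_ _ [_ bl]] := bS i.
by apply: blockP => // _; exists t.
Qed.

Lemma spine0P p : spine kappa b r 0 = val p <->
  val (b 0%N) = (cut kappa (val p).1, (val p).2) /\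
  forall u, u \in leaves kappa (cut kappa (val p).1) -> Some (r 0%N u) = subtree (val p).1 u.
Proof.
rewrite /spine; split.
  rewrite [RHS]surjective_pairing => -[/block0P[b1 H] b2]; split.
    by rewrite [LHS]surjective_pairing b1 b2.
  by move=> u; rewrite -b1; exact: H.
move=> [bE H]; rewrite [RHS]surjective_pairing; congr pair; last by rewrite bE.
by apply/block0P; rewrite bE.
Qed.

(** Both [w] and the mark of the block are leaves on the path to the mark of [p], so
    [leaf_prefix_uniq] identifies them. What remains splits into the block, the trees off the spine
    and the spine one level lower. *)
Lemma spineSP h p p1 w : (val p).2 = w ++ (val p1).2 ->
  w \in leaves kappa (cut kappa (val p).1) -> subtree (val p).1 w = Some (val p1).1 ->
  spine kappa b r h.+1 = val p <->
  [/\ val (b h.+1) = (cut kappa (val p).1, w),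
    forall u, u \in leaves kappa (cut kappa (val p).1) -> u != w ->
      Some (r h.+1 u) = subtree (val p).1 u &
    spine kappa b r h = val p1].
Proof.
move=> vE wl tw; have tk := ttype_spine h; rewrite spineS; split.
  rewrite [RHS]surjective_pairing => -[/(blockSP _ _ tk)[b1 H] b2].
  have wE : (val (b h.+1)).2 = w.
    apply: (leaf_prefix_uniq (kappa := kappa) (t := (val p).1) (v := (val p).2)) => //.
    - by rewrite -b1 markS_leaf.
    - by rewrite -b2 prefix_prefix.
    - by rewrite vE prefix_prefix.
  split.
  - by rewrite [LHS]surjective_pairing b1 wE.
  - by move=> u; rewrite -b1 => /H + uw; rewrite wE (negbTE uw).
  - rewrite [LHS]surjective_pairing [RHS]surjective_pairing; congr pair.
      by apply: Some_inj; rewrite -tw -wE -H ?eqxx//; exact: markS_leaf.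
    by move: b2; rewrite wE vE => /eqP; rewrite eqseq_cat// eqxx => /eqP.
move=> [bE H E]; rewrite [RHS]surjective_pairing vE bE E; congr pair.
apply/blockSP; first by rewrite -E.
rewrite bE; split=> // u ul; rewrite /snd; case: eqP => [->|/eqP]; last exact: H.
by rewrite tw.
Qed.

Hypothesis built : forall i, exists p : mtree G, val p = spine kappa b r i.

(** Along the path to the mark each block contributes just its root: the mark of a block of positive
    index is the root of the next lower one, and in block 0 no vertex of type [kappa] follows the
    root. *)
Lemma spine_marked h p : val p = spine kappa b r h ->
  [/\ mroot_type p = kappa, mark_type p = Some gamma & kpath kappa p = h.+1].
Proof.
elim: h p => [|h IH] p pE.
  have /esym/spine0P[bE H] := pE.
  have pk : mroot_type p = kappa by rewrite /mroot_type pE ttype_spine.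
  have [[b0 _] _ _] := br.
  have pg : mark_type p = Some gamma.
    apply: vtype_cut (_ : vtype (cut kappa (val p).1) _ = _).
    by move: b0; rewrite /mark_type bE.
  split=> //; rewrite kpath_root//; congr S; apply/eqP.
  rewrite -leqn0 leqNgt -has_count; apply/negP => /hasP[j].
  rewrite mem_iota add1n ltnS => /andP[j0]; rewrite leq_eqVlt => /orP[/eqP->|jv].
    rewrite take_size -/(mark_type p) pg => /eqP[gk].
    by have := Hgamma; rewrite gk eqxx.
  have /cut_subtree[_ /(_ j)] : subtree (cut kappa (val p).1) (val p).2.
    by have := valP (b 0%N); rewrite bE.
  by rewrite j0 jv => /(_ isT) + /eqP.
have [p1 p1E] := built h; have [p1k p1g p1h] := IH _ p1E.
have tk := ttype_spine h; move: pE; rewrite spineS [LHS]surjective_pairing => -[/esym].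
move=> /(blockSP _ _ tk)[b1 H] vE.
have wl : (val (b h.+1)).2 \in leaves kappa (cut kappa (val p).1).
  by rewrite -b1 markS_leaf.
have tw : subtree (val p).1 (val (b h.+1)).2 = Some (val p1).1.
  by rewrite -H ?b1// eqxx p1E.
have {}vE : (val p).2 = (val (b h.+1)).2 ++ (val p1).2 by rewrite vE p1E.
have pk : mroot_type p = kappa.
  have [_ bS _] := br; have [_ _ [bk _]] := bS h.
  by rewrite /mroot_type -bk b1.
split=> //; last by rewrite (kpath_leaf pk wl vE tw) p1h.
by rewrite /mark_type vE (vtype_cat _ tw).
Qed.
End Spine.

(** * Law of the spine *)

Section LimitLaw.
Context {R : realType} {G : countType} {d d' : measure_display}
  {W : measurableType d} {W' : measurableType d'}.
Variables (P : probability W R) (P' : probability W' R).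
Variables (sigma : G -> W -> seq G) (alpha : W -> G) (xi : seq nat * G -> W -> seq G).
Hypothesis Hxi : offspring_family P sigma alpha xi.
Variables (kappa gamma : G) (Tk Ts : W -> tree G).
Hypothesis Hgamma : gamma != kappa.
Hypothesis HTk : galton_watson P (cst kappa) xi Tk.
Hypothesis HTs : galton_watson P (cst kappa) (stopped kappa xi) Ts.

(* The masses prescribed on [A] already add up to one. *)
Lemma marks_ae (B : W' -> mtree G) (A : set (mtree G)) (c : R) :
  discrete_rv B -> 0 < c ->
  (forall p, A p -> fine (P' (B @^-1` [set p])) = fine (tree_prob P Ts (val p).1) / c) ->
  (c%:E <= 'E_P[fun w => (count (fun p => `[< A p >]) (markings (Ts w)))%:R])%E ->
  {ae P', forall w, A (B w) /\ (0 < tree_prob P Ts (val (B w)).1)%E}.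
Proof.
move=> mB c0 BA cA; have mTs : discrete_rv Ts := HTs.1.
have mass : P' (B @^-1` A) = 1%E.
  apply/eqP; rewrite eq_le probability_le1/=; last exact: mB.
  rewrite -(@lee_pmul2l _ c%:E)// mule1; apply: le_trans cA _.
  apply: le_trans (mean_markings_le P mTs A) _.
  rewrite (discrete_rv_series P' mB) -nneseriesZl; last by move=> n _; exact: measure_ge0.
  apply: lee_nneseries => [n _ _|n _]; first exact: measure_ge0.
  case E : (pickle_inv n) => [p|]; last first.
    rewrite (_ : _ @^-1` _ = set0) ?measure0 ?mule_ge0 ?lee_fin ?(ltW c0)//.
    by apply/seteqP; split=> w //= [q []]; rewrite E.
  have [Ap|nAp] := pselect (A p); last first.
    rewrite (_ : _ @^-1` _ = set0) ?measure0 ?mule_ge0 ?lee_fin ?(ltW c0)//.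
    by apply/seteqP; split=> w //= [q []]; rewrite E => -[<-].
  have -> : Ts @^-1` marked_at A n = Ts @^-1` [set (val p).1].
    apply/seteqP; split=> w /=; first by move=> [q []]; rewrite E => -[<-].
    by move=> ->; exists p.
  have -> : B @^-1` [set x | Some p = Some x /\ A x] = B @^-1` [set p].
    by apply/seteqP; split=> w /=; [move=> [[->]]|move=> ->].
  rewrite -(fine_probK P' (mB [set p])) BA// -EFinM mulrC divfK ?gt_eqF//.
  by rewrite /tree_prob fine_probK//; exact: mTs.
have aeA : {ae P', forall w, A (B w)}.
  exists (~` (B @^-1` A)); split=> //; first by apply: measurableC; exact: mB.
  by rewrite probability_setC ?mass ?subee//; exact: mB.
have H := discrete_rv_ae P' mB; apply: filterS2 aeA H => w Aw Bw; split=> //.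
rewrite lt0e measure_ge0 andbT; apply: contraTneq Bw => T0.
rewrite -leNgt -(fine_probK P' (mB [set B w])) BA// -/(tree_prob P Ts _) T0.
by rewrite fine0 mul0r.
Qed.

Hypothesis Hcrit : mean_nb P kappa Ts = 2%:E.
Hypothesis Hmean : (0 < mean_nb P gamma Ts < +oo)%E.
Local Notation m := (fine (mean_nb P gamma Ts)).
Local Notation q := (offspring_law P sigma).

Variables (b : nat -> W' -> mtree G) (r : nat -> seq nat -> W' -> tree G).
Hypothesis mpart : forall k, discrete_rv (part b r k).
Hypothesis ipart : mutually_independent P' (part b r).
Hypothesis Hb0 : forall p, mark_type p = Some gamma ->
  fine (P' (b 0%N @^-1` [set p])) = fine (tree_prob P Ts (val p).1) / m.
Hypothesis HbS : forall i p, mark_type p = Some kappa -> (val p).2 != [::] ->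
  P' (b i.+1 @^-1` [set p]) = tree_prob P Ts (val p).1.
Hypothesis Hr : forall i u t, P' (r i u @^-1` [set t]) = tree_prob P Tk t.

Let bw w := (fun i => b i w).
Let rw w := (fun i u => r i u w).

Lemma m_gt0 : 0 < m.
Proof. by case/andP: Hmean => m0 moo; rewrite fine_gt0// m0. Qed.

Lemma proper_parts_ae : {ae P', forall w, proper_parts kappa gamma (bw w) (rw w)}.
Proof.
have mTs : discrete_rv Ts := HTs.1.
have ae0 : {ae P', forall w, mark_type (b 0%N w) = Some gamma /\
    (0 < tree_prob P Ts (val (b 0%N w)).1)%E}.
  have := marks_ae (B := b 0%N) (A := [set p | mark_type p = Some gamma])
    (@mpart (inl 0%N)) m_gt0 Hb0; apply.
  rewrite -mean_nbE fineK//; case/andP: Hmean => m0 moo.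
  by rewrite ge0_fin_numE ?(ltW m0).
have aeS : {ae P', forall w, forall i, (mark_type (b i.+1 w) = Some kappa /\
    (val (b i.+1 w)).2 <> [::]) /\ (0 < tree_prob P Ts (val (b i.+1 w)).1)%E}.
  apply: ae_foralln => i.
  have := marks_ae (B := b i.+1) (A := [set p | mark_type p = Some kappa /\ (val p).2 <> [::]])
    (@mpart (inl i.+1)) ltr01; apply.
    by move=> p [pk /eqP p0]; rewrite divr1 -(HbS i pk p0).
  (* The total mean 2 leaves at least 1 to the non-root vertices, as required by the normalisation
     [c = 1] of these blocks. *)
  have := mean_nb_le1 P mTs kappa; rewrite Hcrit.
  case: ('E_P[_])%E => [x| |] //.
  - by rewrite -EFinD !lee_fin; lra.
  - by move=> _; rewrite leey.
(* The pairs [(i, u)] are enumerated, so that countably many almost sure events are intersected. *)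
have aer : {ae P', forall w, forall n, if @pickle_inv (nat * seq nat)%type n is Some iu
    then ttype (r iu.1 iu.2 w) = kappa else True}.
  apply: ae_foralln => n; case: (pickle_inv n) => [[i u]|]; last exact: aeW.
  have H := discrete_rv_ae P' (@mpart (inr (i, u))); apply: filterS H => w /=.
  rewrite Hr => Tk0; apply: contrapT => /eqP nk.
  have := galton_watson_cst_law Hxi (r i u w) HTk; rewrite (negbTE nk) => T0.
  by move: Tk0; rewrite /tree_prob -fine_probK ?T0 ?ltxx//; exact: (HTk.1).
apply: filterS3 ae0 aeS aer => w [b0 b0s] bS rS; split.
- by split=> //; exact: (stopped_tree_support Hxi HTs b0s).
- by move=> i; have [[bk bn] /(stopped_tree_support Hxi HTs)] := bS i.
- by move=> i u; have := rS (choice.pickle (i, u)); rewrite pickleK_inv.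
Qed.

Definition level (k : nat + nat * seq nat) : nat :=
  match k with inl i => i | inr iu => iu.1 end.

Lemma stopped_cut_prob T : ttype T = kappa ->
  fine (tree_prob P Ts (cut kappa T)) = stopped_weight q kappa (cut kappa T).
Proof.
by move=> Tk0; have [ck cl] := stopped_tree_cut Tk0; exact: (stopped_tree_law Hxi HTs).
Qed.

Lemma leaf_subtree t u : u \in leaves kappa (cut kappa t) ->
  exists2 s, subtree t u = Some s & ttype s = kappa.
Proof.
rewrite mem_leaves => /andP[_ /eqP/vtype_cut]; rewrite /vtype.
by case: subtree => [s|//] [sk]; exists s.
Qed.

Lemma leaves_law i T (L : seq (seq nat)) :
  {subset L <= leaves kappa (cut kappa T)} ->
  \prod_(u <- L) fine (P' (r i u @^-1` [set odflt T (subtree T u)])) =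
  \prod_(u <- L) tree_weight q (odflt T (subtree T u)).
Proof.
move=> LT; rewrite big_seq [RHS]big_seq; apply: eq_bigr => u /LT /leaf_subtree[s -> sk].
by rewrite Hr /tree_prob (galton_watson_cst_law Hxi _ HTk) sk eqxx.
Qed.

(** The event fixes the values [a] of finitely many independent parts, indexed by [L]. Going up one
    level adds a block and the trees off the spine; by [tree_weight_cut] their masses complete the
    weight of [p1] to that of [p]. The division by the mean number of marks comes from block 0
    alone. *)
Lemma spine_event h (p : mtree G) : mroot_type p = kappa -> mark_type p = Some gamma ->
  kpath kappa p = h.+1 ->
  exists (L : seq (nat + nat * seq nat)) (a : forall k, part_type G k),
  [/\ uniq L, (forall k, k \in L -> (level k <= h)%N),
      (forall w, proper_parts kappa gamma (bw w) (rw w) ->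
         spine kappa (bw w) (rw w) h = val p <->
         forall k, k \in L -> part b r k w = a k) &
      \prod_(k <- L) fine (P' (part b r k @^-1` [set a k])) =
      tree_weight q (val p).1 / m].
Proof.
pose key i u : nat + nat * seq nat := inr (i, u).
have key_inj i : injective (key i) by move=> u v [].
elim: h p => [|h IH] p pk pg kp; set T := (val p).1.
  have [s vs] : exists s, subtree T (val p).2 = Some s.
    by have := valP p; rewrite -/T; case: subtree => [s|//] _; exists s.
  have v0 : (val p).2 != [::].
    apply: contra_neq Hgamma => vE; apply: Some_inj.
    by rewrite -pg -pk /mark_type vE.
  have vc : subtree (cut kappa T) (val p).2 = Some (prune kappa s).
    by apply: subtree_cut => // j /andP[j0 jv]; apply: kpath1 => //; rewrite j0 ltnW.
  have pc : subtree (cut kappa T) (val p).2 : bool by rewrite vc.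
  pose p0 : mtree G := exist _ (cut kappa T, (val p).2) pc.
  exists (inl 0%N :: [seq key 0%N u | u <- leaves kappa (cut kappa T)]).
  exists (fun k => match k return part_type G k with
    | inl _ => p0 | inr iu => odflt T (subtree T iu.2) end).
  split.
  - rewrite /= map_inj_uniq// filter_uniq ?vertices_uniq// andbT.
    by apply/mapP => -[].
  - by move=> k; rewrite inE => /orP[/eqP->//|/mapP[u _ ->]].
  - move=> w Hw; rewrite (spine0P Hgamma Hw); split.
      move=> [bE rE] k; rewrite inE => /orP[/eqP->|/mapP[u ul ->]] /=; first exact: val_inj.
      by rewrite -rE.
    move=> H; split; first by have := H (inl 0%N) (mem_head _ _) => /= ; rewrite /bw => ->.
    move=> u ul; have [s' us _] := leaf_subtree ul.
    have /H /= E : key 0%N u \in inl 0%N :: [seq key 0%N u | u <- leaves kappa (cut kappa T)].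
      by rewrite inE mem_map// ul.
    by rewrite /rw E us.
  - rewrite big_cons big_map /= Hb0; last first.
      by rewrite /mark_type /vtype vc /= ttype_prune -pg /mark_type /vtype vs.
    rewrite (_ : fine (tree_prob P Ts _) = stopped_weight q kappa (cut kappa T)).
      by rewrite leaves_law// (tree_weight_cut _ kappa) mulrAC.
    exact: (stopped_cut_prob pk).
have [w [p1 [vE wl tw p1k]]] := kpath_split pk kp.
have p1g : mark_type p1 = Some gamma.
  by rewrite -pg /mark_type vE (vtype_cat _ tw).
have p1h : kpath kappa p1 = h.+1.
  by apply: succn_inj; rewrite -kp (kpath_leaf pk wl vE tw).
have [L [a [uL La Lw LP]]] := IH p1 p1k p1g p1h.
have wc : subtree (cut kappa T) w : bool.
  by move: wl; rewrite mem_leaves /vtype => /andP[_]; case: subtree.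
pose pb : mtree G := exist _ (cut kappa T, w) wc.
pose K := [seq u <- leaves kappa (cut kappa T) | u != w].
(* Level [h.+1] is new because all indices in [L] have level at most [h]; this is why the bound on
   levels is carried through the induction. *)
pose a' k := match k return part_type G k with
  | inl i => if i == h.+1 then pb else a (inl i)
  | inr iu => if iu.1 == h.+1 then odflt T (subtree T iu.2) else a (inr iu) end.
have a'L k : k \in L -> a' k = a k.
  by case: k => [i|[i u]] /La /= ih; rewrite ifN// neq_ltn ltnS ih.
exists (inl h.+1 :: [seq key h.+1 u | u <- K] ++ L), a'; split.
- rewrite /= mem_cat cat_uniq uL map_inj_uniq//.
  rewrite /K !filter_uniq ?vertices_uniq//= andbT; apply/andP; split.
    rewrite negb_or; apply/andP; split; first by apply/mapP => -[].
    by apply/negP => /La /=; rewrite ltnn.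
  by apply/hasPn => k /La kh; apply/mapP => -[u _ kE]; rewrite kE /= ltnn in kh.
- move=> k; rewrite inE mem_cat => /or3P[/eqP->//|/mapP[u _ ->]//|/La].
  exact: leqW.
- move=> o Ho; rewrite (spineSP Ho h vE wl tw); split.
    move=> [bE rE /(Lw _ Ho) sE] k.
    rewrite inE mem_cat => /or3P[/eqP->|/mapP[u uK ->]|kL].
    + by rewrite /a' eqxx; exact: val_inj.
    + move: uK; rewrite mem_filter => /andP[uw ul].
      by rewrite /a' /= eqxx -rE.
    + by rewrite a'L// sE.
  move=> H; split.
  + by have := H (inl h.+1) (mem_head _ _); rewrite /a' eqxx /= /bw => ->.
  + move=> u ul uw; have [s us _] := leaf_subtree ul.
    have /H : key h.+1 u \in inl h.+1 :: [seq key h.+1 u | u <- K] ++ L.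
      by rewrite inE mem_cat mem_map// mem_filter uw ul.
    by rewrite /a' /= eqxx /rw => ->; rewrite us.
  + apply/(Lw _ Ho) => k kL; rewrite -a'L//; apply: H.
    by rewrite inE mem_cat kL !orbT.
- rewrite big_cons big_cat big_map /=.
  have -> : \prod_(k <- L) fine (P' (part b r k @^-1` [set a' k])) =
      tree_weight q (val p1).1 / m.
    by rewrite -LP big_seq [RHS]big_seq; apply: eq_bigr => k kL; rewrite a'L.
  rewrite eqxx HbS//=; last 2 first.
  - by rewrite /mark_type /=; move: wl; rewrite mem_leaves => /andP[_ /eqP].
  - by move: wl; rewrite mem_leaves => /andP[].
  rewrite (_ : fine (tree_prob P Ts _) = stopped_weight q kappa (cut kappa T)); last first.
    exact: (stopped_cut_prob pk).
  rewrite leaves_law; last first.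
    by move=> u; rewrite mem_filter => /andP[].
  (* The leaf [w] is singled out: its factor is the weight of [p1], supplied by the induction
     hypothesis and not by a grafted copy. *)
  rewrite (tree_weight_cut _ kappa T) [X in _ = _ * X / _](bigD1_seq w)//=; last first.
    exact/filter_uniq/vertices_uniq.
  rewrite /K big_filter [in RHS]tw /=; ring.
Qed.

Lemma spine_law h (p : mtree G) (A : set W') : mroot_type p = kappa ->
  mark_type p = Some gamma -> kpath kappa p = h.+1 -> measurable A ->
  {ae P', forall w, proper_parts kappa gamma (bw w) (rw w) ->
     A w <-> spine kappa (bw w) (rw w) h = val p} ->
  fine (P' A) = tree_weight q (val p).1 / m.
Proof.
move=> pk pg kp mA Ap; have [L [a [uL _ Lw <-]]] := spine_event pk pg kp.
rewrite -(independent_seq ipart (fun k => [set a k]) uL); congr fine.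
apply: probability_ae_eq => //.
  apply: measurable_forall_in => k _; exact: (@mpart k [set a k]).
apply: filterS2 Ap proper_parts_ae => w Aw Hw.
by rewrite Aw// Lw.
Qed.
End LimitLaw.

(** * Cylinder sets and the metric *)

Section Cylinders.
Variables (R : realType) (G : countType) (g0 : G).
Implicit Types (x y : mspace R g0) (p : mtree G).

(** By [kfringeP], if the root of [p] has type [kappa], this is the set where $f^{\kappa,[h]}$
    equals [p], for the [h] read off from [p]. *)
Definition cylinder p : set (ptree G) :=
  [set x | pfringe (size (val p).2) x = (p, false)].

Lemma pdist_lt m (x y : ptree G) : pdist R x y < 2 `^ (- m%:R) -> pfringe m x = pfringe m y.
Proof.
rewrite /pdist; case: ifPn => [/eqP xy0|_]; last first.
  rewrite ltNge (@le_trans _ _ 1) ?ler1n// powRN invf_le1 ?powR_gt0//.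
  by rewrite powR_mulrn// exprn_ege1// ler1n.
set t := ereal_sup _; have t0 : (0 <= t)%E by apply: ereal_sup_ubound; exists 0%N.
suff : 2 `^ (- m%:R) > pow2N t -> (m%:R%:E < t)%E.
  move=> /[apply] /ereal_sup_gt[_ [k xyk <-]]; rewrite lte_fin ltr_nat => /ltnW mk.
  exact: pfringe_down xyk.
case: t t0 => [s| |]//= s0; last by rewrite ltry.
rewrite !lte_fin => H; rewrite ltNge; apply/negP => sm; move: H.
by apply/negP; rewrite -leNgt ler_powR ?ler1n// lerN2.
Qed.

Lemma pdist_le m (x y : ptree G) : pfringe m x = pfringe m y -> pdist R x y <= 2 `^ (- m%:R).
Proof.
move=> xym; rewrite /pdist ifT; last exact/eqP/(pfringe_down (leq0n m)).
set t := ereal_sup _; have : (m%:R%:E <= t)%E by apply: ereal_sup_ubound; exists m.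
case: t => [s| |]//= ms.
by rewrite ler_powR ?ler1n// lerN2 -lee_fin.
Qed.

Lemma nbhs_pfringe x m : nbhs x [set y | pfringe m x = pfringe m y].
Proof.
apply/nbhs_ballP; exists (2 `^ (- m%:R)) => /=; first exact: powR_gt0.
by move=> y; exact: pdist_lt.
Qed.

Lemma continuous_pfringe (f : mspace R g0 -> R) x (e : R) : continuous f -> 0 < e ->
  exists m, forall y, pfringe m x = pfringe m y -> `|f x - f y| < e.
Proof.
move=> cf e0; have /cvgrPdist_lt/(_ _ e0)/nbhs_ballP[d /= d0 xd] := cf x.
have [m md] : exists m, 2 `^ (- m%:R) < d.
  exists (Num.truncn d^-1).+1; rewrite powRN invf_plt ?posrE ?powR_gt0//.
  apply: lt_le_trans (truncnS_gt _) _; rewrite powR_mulrn//.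
  by rewrite -natrX ler_nat ltnW// ltn_expl.
by exists m => y xy; apply: xd; apply: le_lt_trans md; exact: pdist_le.
Qed.

Lemma open_cylinder p : open (cylinder p : set (mspace R g0)).
Proof.
rewrite openE => x px; rewrite /interior.
by apply: filterS (nbhs_pfringe x (size (val p).2)) => y xy; exact: etrans (esym xy) px.
Qed.

Lemma measurable_cylinder p : measurable (cylinder p : set (borel_space R g0)).
Proof. by apply: sub_sigma_algebra; exact: open_cylinder. Qed.
End Cylinders.

Section LimitTreeLaw.
Context {R : realType} {G : countType} {d d' : measure_display}
  {W : measurableType d} {W' : measurableType d'}.
Variables (P : probability W R) (P' : probability W' R).
Variables (sigma : G -> W -> seq G) (alpha : W -> G) (xi : seq nat * G -> W -> seq G).
Hypothesis Hxi : offspring_family P sigma alpha xi.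
Variables (kappa gamma : G) (Tk Ts : W -> tree G).
Hypothesis Hgamma : gamma != kappa.
Hypothesis HTk : galton_watson P (cst kappa) xi Tk.
Hypothesis HTs : galton_watson P (cst kappa) (stopped kappa xi) Ts.
Hypothesis Hcrit : mean_nb P kappa Ts = 2%:E.
Hypothesis Hmean : (0 < mean_nb P gamma Ts < +oo)%E.
Variable That : {mfun W' >-> borel_space R kappa}.
Hypothesis HThat : limit_tree kappa P P' gamma Tk Ts That.

Lemma measurable_That (A : set (borel_space R kappa)) :
  measurable A -> measurable (That @^-1` A).
Proof. by move=> mA; rewrite -[_ @^-1` _]setTI; exact: measurable_funPT. Qed.

Lemma kfringe_marked h (p : mtree G) (x : ptree G) : kfringe kappa h x = (Fin p, false) ->
  mroot_type p = kappa /\ kpath kappa p = h.+1.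
Proof.
rewrite /kfringe; case: pselect => [ex|//].
by case: ex_minnP => m /and3P[_ /eqP pk /eqP kp] _ [<-].
Qed.

Lemma That_kfringe_ae : {ae P', forall w, forall h, exists p,
  [/\ kfringe kappa h (That w) = (Fin p, false), mark_type p = Some gamma,
      mroot_type p = kappa & kpath kappa p = h.+1]}.
Proof.
have [b [r [[mpart ipart] Hb0 HbS Hr Hbuilt]]] := HThat.
have Hproper := proper_parts_ae Hxi HTk HTs Hcrit Hmean mpart Hb0 HbS Hr.
apply: filterS2 Hbuilt Hproper => w built proper h.
have spines i : exists p : mtree G, val p = spine kappa (b^~ w) (fun i u => r i u w) i.
  by have [p []] := built i; exists p.
have [p [pE xE]] := built h; exists p.
have [pk pg kp] := spine_marked Hgamma proper spines pE.
by split=> //; apply/(kfringeP _ pk kp); rewrite pE.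
Qed.

Lemma kfringe_That_law h (p : mtree G) : mroot_type p = kappa ->
  mark_type p = Some gamma -> kpath kappa p = h.+1 ->
  fine (P' [set w | kfringe kappa h (That w) = (Fin p, false)]) =
  tree_weight (offspring_law P sigma) (val p).1 / fine (mean_nb P gamma Ts).
Proof.
move=> pk pg kp; have [b [r [[mpart ipart] Hb0 HbS Hr Hbuilt]]] := HThat.
apply: (spine_law Hxi Hgamma HTk HTs Hcrit Hmean mpart ipart Hb0 HbS Hr pk pg kp).
  rewrite (_ : [set w | _] = That @^-1` cylinder p).
    exact: (measurable_That (measurable_cylinder (R := R) (g0 := kappa) p)).
  by apply/seteqP; split=> w /(kfringeP _ pk kp).
apply: filterS Hbuilt => w built proper.
have spines i : exists p : mtree G, val p = spine kappa (b^~ w) (fun i u => r i u w) i.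
  by have [p' []] := built i; exists p'.
have [ph [phE xE]] := built h.
have [phk phg kph] := spine_marked Hgamma proper spines phE.
have {}xE : kfringe kappa h (That w) = (Fin ph, false).
  by apply/(kfringeP _ phk kph); rewrite phE.
by rewrite /= xE -phE; split=> [[->//]|/val_inj ->].
Qed.
End LimitTreeLaw.

(** * Convergence under conditioning *)

Section WithHighProbability.
Context {R : realType} {d : measure_display} {W : measurableType d}.
Variables (P : probability W R) (E : nat -> set W).
Hypotheses (mE : forall n, measurable (E n)) (E0 : forall n, (0 < P (E n))%E).
Implicit Types A B : nat -> set W.

Lemma fine_prob_gt0 n : 0 < fine (P (E n)).
Proof. by rewrite fine_gt0// E0/= -ge0_fin_numE ?fin_num_measure. Qed.

Lemma cond_prob_ge0 n (A : set W) : 0 <= cond_prob P (E n) A.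
Proof. by rewrite divr_ge0// fine_ge0. Qed.

Lemma cond_prob_sub n (A B : set W) : measurable A -> measurable B -> A `<=` B ->
  cond_prob P (E n) A <= cond_prob P (E n) B.
Proof.
move=> mA mB AB; rewrite ler_pM2r ?invr_gt0 ?fine_prob_gt0//.
rewrite fine_le ?fin_num_measure//; try exact: measurableI.
by apply: le_measure; rewrite ?inE; [exact: measurableI..|exact: setSI].
Qed.

Lemma cond_prob_le n (A : set W) : measurable A ->
  cond_prob P (E n) A <= fine (P A) / fine (P (E n)).
Proof.
move=> mA; rewrite ler_pM2r ?invr_gt0 ?fine_prob_gt0//.
rewrite fine_le ?fin_num_measure//; try exact: measurableI.
by apply: le_measure; rewrite ?inE//; exact: measurableI.
Qed.

Lemma cond_probC n (A : set W) : measurable A ->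
  cond_prob P (E n) (~` A) = 1 - cond_prob P (E n) A.
Proof.
move=> mA; apply/eqP; rewrite eq_sym subr_eq -mulrDl -fineD ?fin_num_measure//;
  try by apply: measurableI => //; exact: measurableC.
rewrite -measureU; [|by apply: measurableI => //; exact: measurableC|exact: measurableI|].
  by rewrite -setIUl setUC setUv setTI divff// gt_eqF// fine_prob_gt0.
by rewrite setIACA setICl set0I.
Qed.

Lemma cond_prob_le1 n (A : set W) : measurable A -> cond_prob P (E n) A <= 1.
Proof.
by move=> mA; rewrite -subr_ge0 -cond_probC// cond_prob_ge0.
Qed.

Lemma cond_probU n (A B : set W) : measurable A -> measurable B ->
  cond_prob P (E n) (A `|` B) <= cond_prob P (E n) A + cond_prob P (E n) B.
Proof.
move=> mA mB; rewrite -mulrDl ler_pM2r ?invr_gt0 ?fine_prob_gt0//.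
have mAE : measurable (A `&` E n) by exact: measurableI.
have mBE : measurable (B `&` E n) by exact: measurableI.
rewrite setIUl -fineD ?fin_num_measure// fine_le ?fin_num_measure//.
- exact: measurableU.
- by rewrite fin_numD !fin_num_measure.
- exact: measureU2.
Qed.

Definition whp A := (fun n => cond_prob P (E n) (A n)) @ \oo --> (1 : R).

Lemma whp_sub A B : (forall n, measurable (A n)) -> (forall n, measurable (B n)) ->
  (\forall n \near \oo, A n `<=` B n) -> whp A -> whp B.
Proof.
move=> mA mB AB hA; have H : \forall n \near \oo,
    cond_prob P (E n) (A n) <= cond_prob P (E n) (B n) <= 1.
  by apply: filterS AB => n ABn; rewrite cond_prob_sub//= cond_prob_le1.
exact: (squeeze_cvgr H hA (cvg_cst _)).
Qed.

Lemma whpC A : (forall n, measurable (A n)) ->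
  whp (fun n => ~` A n) <-> (fun n => cond_prob P (E n) (A n)) @ \oo --> (0 : R).
Proof.
move=> mA; rewrite /whp; under eq_fun do rewrite cond_probC//.
split=> H.
  rewrite (_ : (fun n => _) = fun n => 1 - (1 - cond_prob P (E n) (A n))).
    by rewrite -[X in _ --> X](subrr 1); exact: cvgB (cvg_cst _) H.
  by apply/funext => n; rewrite opprB addrC subrK.
by rewrite -[X in _ --> X](subr0 1); exact: cvgB (cvg_cst _) H.
Qed.

Lemma whpI A B : (forall n, measurable (A n)) -> (forall n, measurable (B n)) ->
  whp A -> whp B -> whp (fun n => A n `&` B n).
Proof.
move=> mA mB hA hB.
have H : (fun n => cond_prob P (E n) (A n) + cond_prob P (E n) (B n) - 1) @ \oo --> (1 : R).
  by rewrite -[X in _ --> X](addrK 1 1); exact: cvgB (cvgD hA hB) (cvg_cst _).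
have AB : \forall n \near \oo,
    cond_prob P (E n) (A n) + cond_prob P (E n) (B n) - 1 <=
    cond_prob P (E n) (A n `&` B n) <= 1.
  apply: nearW => n /=; rewrite cond_prob_le1 ?andbT; last exact: measurableI.
  have := cond_probU n (measurableC (mA n)) (measurableC (mB n)).
  by rewrite -setCI !cond_probC//; [lra|exact: measurableI].
exact: (squeeze_cvgr AB H (cvg_cst _)).
Qed.

Lemma whpT : whp (fun=> setT).
Proof.
rewrite /whp (_ : (fun n => _) = cst 1); first exact: cvg_cst.
by apply/funext => n; rewrite /cond_prob setTI divff// gt_eqF// fine_prob_gt0.
Qed.

Lemma whp_all (I : eqType) (L : seq I) (A : I -> nat -> set W) :
  (forall i n, measurable (A i n)) -> (forall i, i \in L -> whp (A i)) ->
  whp (fun n => [set w | forall i, i \in L -> A i n w]).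
Proof.
move=> mA; elim: L => [|i L IH] hA.
  rewrite (_ : (fun n => _) = fun=> setT); first exact: whpT.
  by apply/funext => n; apply/seteqP; split.
have mL n : measurable [set w | forall j, j \in L -> A j n w].
  by apply: measurable_forall_in => j _.
apply: whp_sub (whpI (mA i) mL (hA i (mem_head _ _)) (IH _)).
- by move=> n; apply: measurableI.
- by move=> n; apply: measurable_forall_in => j _.
- apply: nearW => n w [Ai H] j; rewrite inE => /orP[/eqP->//|]; exact: H.
- by move=> j jL; apply: hA; rewrite inE jL orbT.
Qed.
End WithHighProbability.

(** * Fringe counts in the conditioned tree *)

Section FringeCounts.
Context {R : realType} {G : countType} {d : measure_display} {W : measurableType d}.
Variables (P : probability W R) (sigma : G -> W -> seq G) (alpha : W -> G)
  (xi : seq nat * G -> W -> seq G) (T : W -> tree G) (kappa : G).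
Hypotheses (Hxi : offspring_family P sigma alpha xi) (HT : galton_watson P alpha xi T).
Variables (E : nat -> set W) (s : nat -> R).
Hypotheses (mE : forall n, measurable (E n)) (E0 : forall n, (0 < P (E n))%E).
Hypothesis (Hs : s @ \oo --> +oo).
Hypothesis Hexp : forall eps : R, 0 < eps ->
  (fun n => expR (- eps * s n)) =o_\oo (fun n => fine (P (E n))).
Hypothesis Hbig : (fun n => cond_prob P (E n)
  [set w | s n <= (nb_type kappa (T w))%:R]) @ \oo --> (1 : R).

Lemma measurable_T (A : set (tree G)) : measurable [set w | A (T w)].
Proof. exact: (HT.1 A). Qed.

Lemma whp_tail (A : nat -> set W) (c : R) : 0 < c -> (forall n, measurable (A n)) ->
  (forall n, fine (P (A n)) <= 2 * expR (- c * s n)) -> whp P E (fun n => ~` A n).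
Proof.
move=> c0 mA Ac; apply/(whpC mE E0 mA)/cvgr0Pnorm_le => e e0.
have e20 : 0 < e / 2 by rewrite divr_gt0.
have /eqoP/(_ _ e20) := Hexp c0; apply: filterS => n.
rewrite ger0_norm ?expR_ge0// (gtr0_norm (fine_prob_gt0 mE E0 n)) => H.
rewrite ger0_norm ?cond_prob_ge0//; apply: le_trans (cond_prob_le mE E0 n (mA n)) _.
rewrite ler_pdivrMr ?fine_prob_gt0//; have := Ac n; lra.
Qed.

(** The positivity of the number of vertices of type [kappa], due to s_n tending to infinity, is
    recorded because the next step divides by it. *)
Lemma occurrences_whp (t0 : tree G) (e : R) : ttype t0 = kappa -> 0 < e ->
  whp P E (fun n => [set w | 0 < ((nb_type kappa (T w))%:R : R) /\
    `|(occurrences t0 (T w))%:R -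
      tree_weight (offspring_law P sigma) t0 * (nb_type kappa (T w))%:R| <=
    e * (nb_type kappa (T w))%:R]).
Proof.
move=> t0k e0; have [c c0 tail] := occurrences_tail Hxi HT t0k e0.
set w0 := tree_weight _ _.
pose far n := [set w | s n <= (nb_type kappa (T w))%:R /\ e * (nb_type kappa (T w))%:R <
  `|(occurrences t0 (T w))%:R - w0 * (nb_type kappa (T w))%:R|].
have mfar n : measurable (far n).
  exact: (measurable_T [set t | s n <= (nb_type kappa t)%:R /\
    e * (nb_type kappa t)%:R < `|(occurrences t0 t)%:R - w0 * (nb_type kappa t)%:R|]).
have mbig n : measurable [set w | s n <= (nb_type kappa (T w))%:R].
  exact: (measurable_T [set t | s n <= (nb_type kappa t)%:R]).
have mnear : measurable [set w | 0 < ((nb_type kappa (T w))%:R : R) /\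
    `|(occurrences t0 (T w))%:R - w0 * (nb_type kappa (T w))%:R| <=
    e * (nb_type kappa (T w))%:R].
  exact: (measurable_T [set t | 0 < ((nb_type kappa t)%:R : R) /\
    `|(occurrences t0 t)%:R - w0 * (nb_type kappa t)%:R| <= e * (nb_type kappa t)%:R]).
have hfar : whp P E (fun n => ~` far n) by apply: (whp_tail c0 mfar) => n; exact: tail.
apply: (whp_sub mE E0 _ _ _ (whpI mE E0 mbig (fun n => measurableC (mfar n)) Hbig hfar)).
- by move=> n; apply: measurableI => //; exact: measurableC.
- by [].
- have /cvgryPgt/(_ 0) := Hs; apply: filterS => n sn w [/= bw nf].
  split; first exact: lt_le_trans bw.
  by rewrite leNgt; apply/negP => f; apply: nf.
Qed.

Lemma occurrences_cvg (t0 : tree G) (m : R) : ttype t0 = kappa -> 0 < m ->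
  cvg_in_cond_prob P E
    (fun w => (occurrences t0 (T w))%:R / (m * (nb_type kappa (T w))%:R))
    (tree_weight (offspring_law P sigma) t0 / m).
Proof.
move=> t0k m0 eps eps0; set w0 := tree_weight _ _.
pose A (_ : nat) := [set w | eps <
    `|(occurrences t0 (T w))%:R / (m * (nb_type kappa (T w))%:R) - w0 / m|].
have mA n : measurable (A n).
  exact: (measurable_T [set t | eps <
    `|(occurrences t0 t)%:R / (m * (nb_type kappa t)%:R) - w0 / m|]).
apply: (whpC mE E0 mA).1.
apply: (whp_sub mE E0 _ (fun n => measurableC (mA n)) _
  (occurrences_whp t0k (mulr_gt0 eps0 m0))).
  move=> _; exact: (measurable_T [set t | 0 < ((nb_type kappa t)%:R : R) /\
    `|(occurrences t0 t)%:R - w0 * (nb_type kappa t)%:R| <=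
    eps * m * (nb_type kappa t)%:R]).
apply: nearW => n w [/= k0 H]; apply/negP; rewrite -leNgt.
set x : R := (occurrences t0 (T w))%:R in H *.
set k : R := (nb_type kappa (T w))%:R in k0 H *.
have -> : x / (m * k) - w0 / m = (x - w0 * k) / (m * k).
  by field; rewrite !gt_eqF.
have mk0 : 0 < m * k by exact: mulr_gt0.
by rewrite normrM (gtr0_norm (_ : 0 < (m * k)^-1)) ?invr_gt0// ler_pdivrMr// mulrA.
Qed.
End FringeCounts.

(** * Weak convergence *)

Section StepFunctions.
Context {R : realType} {d : measure_display} {X : measurableType d}.
Variables (mu : probability X R) (I : eqType) (B : I -> set X).
Hypothesis mB : forall i, measurable (B i).

Lemma integral_step (c : R) (a : I -> R) (L : seq I) :
  mu.-integrable setT (EFin \o (fun x => c + \sum_(i <- L) a i * \1_(B i) x)) /\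
  Rintegral mu setT (fun x => c + \sum_(i <- L) a i * \1_(B i) x) =
  c + \sum_(i <- L) a i * fine (mu (B i)).
Proof.
elim: L => [|i L [IHi IHe]].
  split.
    apply: eq_integrable (finite_measure_integrable_cst mu c measurableT) => //.
    by move=> x _; rewrite /= big_nil addr0.
  transitivity (Rintegral mu setT (fun=> c)).
    by apply: eq_Rintegral => x _; rewrite big_nil addr0.
  rewrite Rintegral_cst// big_nil addr0 -[RHS]mulr1; congr (_ * _).
  exact: (congr1 fine (probability_setT mu)).
have i1 : mu.-integrable setT (EFin \o (\1_(B i) : X -> R)) by exact: integrable_indic.
have ia : mu.-integrable setT (EFin \o (fun x => a i * \1_(B i) x)).
  exact: (integrableZl measurableT (a i) i1).
split.
  apply: eq_integrable (integrableD measurableT ia IHi) => // x _.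
  by rewrite /= -EFinD big_cons addrCA.
transitivity (Rintegral mu setT (fun x => a i * \1_(B i) x +
    (c + \sum_(i <- L) a i * \1_(B i) x))).
  by apply: eq_Rintegral => x _; rewrite big_cons addrCA.
rewrite RintegralD// IHe RintegralZl// big_cons [RHS]addrCA; congr (_ * _ + _).
by rewrite /Rintegral integral_indic// setIT.
Qed.

Variables (f : X -> R) (M : R).
Hypotheses (mf : measurable_fun setT f) (fM : forall x, `|f x| <= M).

Lemma bounded_integrable : mu.-integrable setT (EFin \o f).
Proof.
apply: measurable_bounded_integrable => //; first by rewrite ltey_eq fin_num_measure.
exists M; split; first exact: num_real.
by move=> r Mr x _; apply: le_trans (fM x) (ltW Mr).
Qed.

(** On a set [B i] the function is within [e] of [a i], elsewhere it is bounded by [M]. So it lies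
    between two step functions with coefficients [a i + M] and [a i - M] and constants -(e + M) and
    e + M, and the error involves only the masses of the sets. *)
Lemma integral_step_approx (a : I -> R) (e : R) (L : seq I) : uniq L ->
  (forall i j x, i \in L -> j \in L -> B i x -> B j x -> i = j) ->
  (forall i, `|a i| <= M) -> 0 <= e ->
  (forall i x, i \in L -> B i x -> `|f x - a i| <= e) ->
  `|Rintegral mu setT f - \sum_(i <- L) a i * fine (mu (B i))| <=
  e + M * (1 - \sum_(i <- L) fine (mu (B i))).
Proof.
move=> uL dB aM e0 fa.
have M0 : 0 <= M by exact: le_trans (fM point).
have pointwise x : `|f x - \sum_(i <- L) a i * \1_(B i) x| <=
    e + M * (1 - \sum_(i <- L) \1_(B i) x).
  have [[i iL Bix]|none] := pselect (exists2 i, i \in L & B i x).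
    have out j : j \in L -> j != i -> \1_(B j) x = 0 :> R.
      move=> jL ji; rewrite indicE memNset// => Bjx.
      by move/eqP: ji; apply; exact: dB Bjx Bix.
    have one : \1_(B i) x = 1 :> R by rewrite indicE mem_set.
    have single (F : I -> R) : (forall j, j \in L -> j != i -> F j = 0) ->
        \sum_(j <- L) F j = F i.
      move=> F0; rewrite (bigD1_seq i)//= big_seq_cond big1 ?addr0// => j /andP[].
      exact: F0.
    rewrite !single ?one => [|j jL ji|j jL ji]; rewrite ?out ?mulr0//.
    by rewrite mulr1 subrr mulr0 addr0 fa.
  have out j : j \in L -> \1_(B j) x = 0 :> R.
    by move=> jL; rewrite indicE memNset// => Bjx; apply: none; exists j.
  have zero (F : I -> R) : (forall j, j \in L -> F j = 0) -> \sum_(j <- L) F j = 0.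
    by move=> F0; rewrite big_seq big1.
  rewrite !zero => [|j jL|j jL]; rewrite ?out ?mulr0//.
  by rewrite !subr0 mulr1 (le_trans (fM x))// lerDr.
have [iu eu] := integral_step (e + M) (fun i => a i - M) L.
have [il el] := integral_step (- (e + M)) (fun i => a i + M) L.
rewrite ler_norml; apply/andP; split.
  have : Rintegral mu setT (fun x => - (e + M) + \sum_(i <- L) (a i + M) * \1_(B i) x)
      <= Rintegral mu setT f.
    apply: le_Rintegral => //; first exact: bounded_integrable.
    move=> x _; have := pointwise x; rewrite ler_norml => /andP[+ _].
    under [X in _ -> _ + X <= _]eq_bigr do rewrite mulrDl.
    rewrite big_split /= -mulr_sumr; lra.
  rewrite el; under eq_bigr do rewrite mulrDl.
  rewrite big_split /= -mulr_sumr; lra.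
have : Rintegral mu setT f <=
    Rintegral mu setT (fun x => e + M + \sum_(i <- L) (a i - M) * \1_(B i) x).
  apply: le_Rintegral => //; first exact: bounded_integrable.
  move=> x _; have := pointwise x; rewrite ler_norml => /andP[_ +].
  under [X in _ -> _ <= _ + X]eq_bigr do rewrite mulrBl.
  rewrite sumrB /= -mulr_sumr; lra.
rewrite eu; under eq_bigr do rewrite mulrBl.
rewrite sumrB /= -mulr_sumr; lra.
Qed.
End StepFunctions.

Lemma borel_measurable_continuous (R : realType) (G : countType) (g0 : G)
  (f : mspace R g0 -> R) : continuous f ->
  measurable_fun setT (f : borel_space R g0 -> R).
Proof.
move=> cf; apply: (measurability _ (RGenOpens.measurableE R)).
move=> _ [_ [x [y ->]] <-]; rewrite setTI; apply: sub_sigma_algebra.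
by move/continuousP: cf; apply; exact: itv_open.
Qed.

Lemma discrete_rv_singletons d (W : measurableType d) (S : countType) (X : W -> S) :
  (forall x, measurable (X @^-1` [set x])) -> discrete_rv X.
Proof.
move=> mX A; rewrite (_ : X @^-1` A = \bigcup_n
    (if @pickle_inv S n is Some x then X @^-1` [set y | y = x /\ A x] else set0)).
  apply: bigcupT_measurable => n; case: (pickle_inv n) => [x|]; last exact: measurable0.
  have [Ax|nAx] := pselect (A x).
    rewrite (_ : _ @^-1` _ = X @^-1` [set x])//.
    by apply/seteqP; split=> w //= [].
  rewrite (_ : _ @^-1` _ = set0)//.
  by apply/seteqP; split=> w //= [].
apply/seteqP; split=> w /=.
  by move=> Aw; exists (choice.pickle (X w)) => //=; rewrite pickleK_inv.
by move=> [n _]; case: (pickle_inv n) => //= x [-> ].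
Qed.

Lemma fringe_self (G : countType) (p : mtree G) : cylinder p (Fin p).
Proof.
exact: ((fringeP (size (val p).2) p p).2
  (ex_intro2 _ _ [::] erefl (conj erefl erefl))).1.
Qed.

(** With u = x / (m k) and v = y / k one has x / y - a = (m (u - a) + a (m - v)) / v. The numerator
    is at most m e / 2, and v >= 3 m / 4 because e <= 1. *)
Lemma ratio_approx (R : realType) (x y k a m e : R) : 0 < m -> 0 < e -> e <= 1 ->
  0 <= k -> 0 <= a <= 1 -> `|x / (m * k) - a| <= e / 4 -> `|y / k - m| <= m * e / 4 ->
  0 < y /\ `|x / y - a| <= e.
Proof.
move=> m0 e0 e1 k0 /andP[a0 a1] xa ym; set v := y / k in ym; set u := x / (m * k) in xa.
have me0 : 0 < m * e by exact: mulr_gt0.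
have v34 : 3 / 4 * m <= v by move: ym; rewrite ler_norml => /andP[+ _]; nra.
have v0 : 0 < v by apply: lt_le_trans v34; rewrite mulr_gt0.
have kpos : 0 < k.
  (* Division by zero returns zero, so [k = 0] would force [v = 0]. *)
  rewrite lt0r k0 andbT; apply: contraTneq v0 => k00.
  by rewrite /v k00 invr0 mulr0 ltxx.
have yE : y = v * k by rewrite /v divfK// gt_eqF.
have y0 : 0 < y by rewrite yE mulr_gt0.
split=> //; have -> : x / y - a = (m * (u - a) + a * (m - v)) / v.
  by rewrite yE /u; field; rewrite !gt_eqF.
rewrite normrM (gtr0_norm (_ : 0 < v^-1)) ?invr_gt0// ler_pdivrMr//.
apply: le_trans (ler_normD _ _) _; rewrite !normrM (gtr0_norm m0) (ger0_norm a0) (distrC m).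
nra.
Qed.

(** * Partition of the limit space by fringes *)

Section FringePartition.
Context {R : realType} {G : countType} {d' : measure_display} {W' : measurableType d'}.
Variables (P' : probability W' R) (kappa gamma : G).
Variable That : {mfun W' >-> borel_space R kappa}.
Hypothesis That_kfringe : {ae P', forall w, forall h, exists p,
  [/\ kfringe kappa h (That w) = (Fin p, false), mark_type p = Some gamma,
      mroot_type p = kappa & kpath kappa p = h.+1]}.

(** Taking values in a countable type makes the lemmas on discrete random variables applicable to
    the infinite tree. *)
Definition kvalue k (x : ptree G) : option (mtree G) :=
  if kfringe kappa k x is (Fin p, false) then Some p else None.

Lemma kvalueP k x p : kvalue k x = Some p <-> kfringe kappa k x = (Fin p, false).
Proof.
rewrite /kvalue; case: (kfringe kappa k x) => -[q|q] [] //; split=> // -[->//].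
Qed.

Lemma kvalue_rv k : discrete_rv (kvalue k \o (That : W' -> ptree G)).
Proof.
have mSome p : measurable ((kvalue k \o (That : W' -> ptree G)) @^-1` [set Some p]).
  have [[pk kp]|np] := pselect (mroot_type p = kappa /\ kpath kappa p = k.+1).
    rewrite (_ : _ @^-1` _ = That @^-1` cylinder p).
      exact: (measurable_That That (measurable_cylinder (R := R) (g0 := kappa) p)).
    by apply/seteqP; split=> w /=; [move=> /kvalueP/(kfringeP _ pk kp)|
      move=> /(kfringeP _ pk kp)/kvalueP].
  rewrite (_ : _ @^-1` _ = set0)//; apply/seteqP; split=> w //= /kvalueP.
  by move=> /kfringe_marked /np.
apply: discrete_rv_singletons => -[p|]; first exact: mSome.
rewrite -[X in measurable X]setCK; apply: measurableC.
rewrite (_ : ~` _ = \bigcup_n (if @pickle_inv (mtree G) n is Some p then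
    (kvalue k \o (That : W' -> ptree G)) @^-1` [set Some p] else set0)).
  apply: bigcupT_measurable => n; case: (pickle_inv n) => [p|]; last exact: measurable0.
  exact: mSome.
apply/seteqP; split=> w /=.
  case E : (kvalue k (That w)) => [p|] // _.
  by exists (choice.pickle p) => //=; rewrite pickleK_inv.
by move=> [n _]; case: (pickle_inv n) => //= p ->.
Qed.

Definition small_osc (f : mspace R kappa -> R) e k (p : mtree G) := [/\ mroot_type p = kappa,
  mark_type p = Some gamma, kpath kappa p = k.+1 &
  forall x y, cylinder p x -> cylinder p y -> `|f x - f y| <= e].

Lemma kpath_le_size (p : mtree G) : (kpath kappa p <= (size (val p).2).+1)%N.
Proof. by apply: leq_trans (count_size _ _) _; rewrite size_iota. Qed.

(** Continuity at the limit tree gives a height [k], depending on the outcome, beyond which [f]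
    moves by less than [e / 2]. A path with [(k + h).+1] vertices of type [kappa] has at least [k]
    edges, so the cylinders of these levels are small enough. *)
Lemma small_osc_ae (f : mspace R kappa -> R) (e : R) : continuous f -> 0 < e ->
  {ae P', forall w, exists k, forall h, exists2 p, kvalue (k + h) (That w) = Some p &
    small_osc f e (k + h) p}.
Proof.
move=> cf e0; apply: filterS That_kfringe => w Hw.
have e20 : 0 < e / 2 by rewrite divr_gt0.
have [k Hk] := continuous_pfringe (That w : mspace R kappa) cf e20.
exists k => h; have [p [/[dup] /kvalueP pE pE' pg pk kp]] := Hw (k + h)%N.
exists p => //; split=> // x y px py.
have kv : (k <= size (val p).2)%N.
  by have := kpath_le_size p; rewrite kp ltnS; apply: leq_trans; exact: leq_addr.
have wp : cylinder p (That w) by exact/(kfringeP _ pk kp).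
have near z : cylinder p z -> `|f (That w) - f z| < e / 2.
  by move=> pz; apply: Hk; apply: (pfringe_down kv); rewrite wp pz.
have := near x px; have := near y py; rewrite !ltr_norml ler_norml => /andP[? ?] /andP[? ?].
by apply/andP; split; lra.
Qed.

Lemma fringe_partition (f : mspace R kappa -> R) (e : R) : continuous f -> 0 < e ->
  exists k (L : seq (mtree G)), [/\ uniq L, forall p, p \in L -> small_osc f e k p &
    1 - e <= \sum_(p <- L) fine (P' (That @^-1` cylinder p))].
Proof.
move=> cf e0; pose S k := [set o | exists2 p, o = Some p & small_osc f e k p].
pose D k := (kvalue k \o (That : W' -> ptree G)) @^-1` (S k).
(* Good behaviour at level [k] alone is not visibly monotone in [k]. Asking for it at all later
   levels too gives increasing events with a union of probability one. *)
pose J k := \bigcap_h D (k + h)%N.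
have mD k : measurable (D k) by exact: kvalue_rv.
have mJ k : measurable (J k) by exact: bigcapT_measurable.
have mJU : measurable (\bigcup_k J k) by exact: bigcupT_measurable.
have J1 : P' (\bigcup_k J k) = 1%E.
  rewrite -(probability_setT P'); apply: probability_ae_eq => //.
  apply: filterS (small_osc_ae cf e0) => w [k Hk]; split=> // _.
  by exists k => // h _; have [p pE pS] := Hk h; exists p.
have ndJ : nondecreasing_seq J.
  move=> k l kl; apply/subsetPset => w Jw h _.
  by have := Jw (l - k + h)%N I; rewrite addnA subnKC.
have cvgJ : (fun k => P' (J k)) @ \oo --> 1%E.
  by rewrite -J1; exact: (nondecreasing_cvg_mu mJ mJU ndJ).
have [k Jk] : exists k, ((1 - e)%:E < P' (J k))%E.
  have V : nbhs (1%E : \bar R) [set x | ((1 - e)%:E < x)%E].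
    by apply: open_nbhs_nbhs; split; [exact: open_ereal_gt_ereal|rewrite /= lte_fin; lra].
  by have [k _ /(_ k (leqnn k))] := cvgJ _ V; exists k.
have Dk : ((1 - e)%:E < P' (D k))%E.
  apply: lt_le_trans Jk _; apply: le_measure; rewrite ?inE//.
  by move=> w /(_ 0%N I); rewrite addn0.
have [L [uL LS sL]] : exists L, [/\ uniq L, forall o, o \in L -> S k o &
    1 - e < \sum_(o <- L) fine (P' ((kvalue k \o (That : W' -> ptree G)) @^-1` [set o]))].
  apply: contrapT => nL; move: Dk; rewrite ltNge; apply/negP; rewrite negbK.
  apply: (discrete_rv_le (kvalue_rv k)) => L uL LS.
  by rewrite leNgt; apply/negP => sL; apply: nL; exists L.
exists k, (pmap id L); split.
- by apply: (pmap_uniq (g := Some)) => // -[].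
- move=> p; rewrite mem_pmap map_id => /LS[q [->]].
  by [].
- apply/ltW; apply: lt_le_trans sL _; rewrite big_pmap big_seq [leRHS]big_seq.
  apply: ler_sum => o /LS[p -> [pk pg kp _]] /=.
  rewrite le_eqVlt; apply/orP; left; apply/eqP; congr (fine (P' _)).
  by apply/seteqP; split=> w /=; [move=> /kvalueP/(kfringeP _ pk kp)|
    move=> /(kfringeP _ pk kp)/kvalueP].
Qed.
End FringePartition.

Section WeakTopology.
Variables (R : realType) (X : ptopologicalType).

(** The weak topology is initial for integration into a space of functions with pointwise
    convergence, so one test function at a time is enough. An arbitrary filter is allowed for the
    sake of [limit_cvg]. *)
Lemma weak_probability_cvg (F : set_system (weak_probability R X))
    (c : weak_probability R X) : Filter F ->
  (forall f e, 0 < e -> F [set mu | `|integrate mu f - integrate c f| < e]) -> F --> c.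
Proof.
move=> FF H.
have Hptws : (integrate (R := R) (X := X) @ F) -->
    (integrate c : {ptws bounded_continuous R X -> R}).
  apply/cvg_sup => f U [V [[A oA <-] Ac AU]].
  have /nbhs_ballP[e /= e0 eA] : nbhs (integrate c f) A by apply: open_nbhs_nbhs.
  have FA : F [set mu | A (integrate mu f)].
    apply: filterS (H f e e0) => mu mue; apply: eA.
    by rewrite /ball /= distrC.
  by apply: (filterS (F := integrate (R := R) (X := X) @ F) AU); exact: FA.
move=> U [V [[A oA <-] Ac AU]]; apply: filterS AU _.
by apply: Hptws; apply: open_nbhs_nbhs.
Qed.
End WeakTopology.

Section UniformMarking.
Context {R : realType} {G : countType} (kappa gamma : G).

Lemma cylinder_mark (p q : mtree G) : cylinder p (Fin q) -> mark_type q = mark_type p.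
Proof.
move=> qp; have [w qE [qw _]] := (fringeP (size (val p).2) p q).1 (conj qp erefl).
by rewrite /mark_type qE (vtype_cat _ qw).
Qed.

(** A marking in the cylinder inherits its mark type from [p], so the restriction to marks of type
    [gamma] leaves the count of occurrences unchanged. *)
Lemma uniform_marking_cylinder (L : tree G -> weak_probability R (mspace R kappa))
    (t : tree G) (p : mtree G) k : uniform_marking gamma L -> (0 < nb_type gamma t)%N ->
  mroot_type p = kappa -> mark_type p = Some gamma -> kpath kappa p = k.+1 ->
  fine ((L t : probability (borel_space R kappa) R) (cylinder p)) =
  (occurrences (val p).1 t)%:R / (nb_type gamma t)%:R.
Proof.
move=> HL t0 pk pg kp; rewrite (HL t t0); last exact: measurable_cylinder.
rewrite /= -(NoccurE t pk kp); congr (_%:R / _); apply: eq_count => q.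
apply/andP/asboolP => [[_ /asboolP qp]|]; first exact/(kfringeP _ pk kp).
by move=> /(kfringeP _ pk kp) qp; split; [apply/eqP; rewrite (cylinder_mark qp)|exact/asboolP].
Qed.
End UniformMarking.

Lemma cylinder_disjoint (G : countType) (kappa : G) k (p q : mtree G) (x : ptree G) :
  mroot_type p = kappa -> kpath kappa p = k.+1 ->
  mroot_type q = kappa -> kpath kappa q = k.+1 ->
  cylinder p x -> cylinder q x -> p = q.
Proof.
move=> pk kp qk kq /(kfringeP _ pk kp) + /(kfringeP _ qk kq).
by move=> -> [].
Qed.

(** The masses [u] miss at most 2 e and the masses [v] at most e, so the two approximations cost e +
    2 M e and e + M e. Replacing [u] by [v] in the step sum costs another M e. *)
Lemma step_sums_close (R : realType) (I : eqType) (K : seq I) (a u v : I -> R)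
    (M e e1 x y : R) : 0 <= M -> (forall i, `|a i| <= M) ->
  (forall i, i \in K -> `|u i - v i| <= e1) -> (size K)%:R * e1 <= e ->
  1 - e <= \sum_(i <- K) v i ->
  `|x - \sum_(i <- K) a i * u i| <= e + M * (1 - \sum_(i <- K) u i) ->
  `|y - \sum_(i <- K) a i * v i| <= e + M * (1 - \sum_(i <- K) v i) ->
  `|x - y| <= 2 * e + 4 * M * e.
Proof.
move=> M0 aM uv Ke ve xu yv.
have size_sum (F : I -> R) (b : R) : (forall i, i \in K -> `|F i| <= b) ->
    `|\sum_(i <- K) F i| <= (size K)%:R * b.
  move=> Fb; apply: le_trans (ler_norm_sum _ _ _) _; rewrite big_seq.
  apply: le_trans (ler_sum _ Fb) _.
  by rewrite -big_seq big_const_seq count_predT iter_addr addr0 mulr_natl.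
have uvS : `|\sum_(i <- K) u i - \sum_(i <- K) v i| <= e.
  by rewrite -sumrB; apply: le_trans Ke; exact: size_sum.
have auvS : `|\sum_(i <- K) a i * u i - \sum_(i <- K) a i * v i| <= M * e.
  rewrite -sumrB; apply: le_trans (_ : (size K)%:R * (M * e1) <= _).
    by apply: size_sum => i iK; rewrite -mulrBr normrM ler_pM// uv.
  by rewrite mulrCA ler_wpM2l.
have Mu : M * (1 - \sum_(i <- K) u i) <= M * (2 * e).
  by rewrite ler_wpM2l//; move: uvS; rewrite ler_norml => /andP[+ _]; lra.
have Mv : M * (1 - \sum_(i <- K) v i) <= M * e by rewrite ler_wpM2l//; lra.
move: xu yv auvS; rewrite !ler_norml => /andP[? ?] /andP[? ?] /andP[? ?].
by apply/andP; split; lra.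
Qed.

(** * Convergence of the conditional laws *)

Section WeakLimit.
Context {R : realType} {G : countType} {d d' : measure_display}
  {W : measurableType d} {W' : measurableType d'}.
Variables (P : probability W R) (P' : probability W' R).
Variables (sigma : G -> W -> seq G) (alpha : W -> G) (xi : seq nat * G -> W -> seq G)
  (T : W -> tree G).
Hypotheses (Hxi : offspring_family P sigma alpha xi) (HT : galton_watson P alpha xi T).
Variables (kappa gamma : G) (Tk Ts : W -> tree G).
Hypothesis Hgamma : gamma != kappa.
Hypothesis HTk : galton_watson P (cst kappa) xi Tk.
Hypothesis HTs : galton_watson P (cst kappa) (stopped kappa xi) Ts.
Variables (E : nat -> set W) (s : nat -> R).
Hypotheses (mE : forall n, measurable (E n)) (E0 : forall n, (0 < P (E n))%E).
Hypothesis Hcrit : mean_nb P kappa Ts = 2%:E.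
Hypothesis (Hs : s @ \oo --> +oo).
Hypothesis Hexp : forall eps : R, 0 < eps ->
  (fun n => expR (- eps * s n)) =o_\oo (fun n => fine (P (E n))).
Hypothesis Hbig : (fun n => cond_prob P (E n)
  [set w | s n <= (nb_type kappa (T w))%:R]) @ \oo --> (1 : R).
Hypothesis Hmean : (0 < mean_nb P gamma Ts < +oo)%E.
Variable That : {mfun W' >-> borel_space R kappa}.
Hypothesis HThat : limit_tree kappa P P' gamma Tk Ts That.
Local Notation m := (fine (mean_nb P gamma Ts)).

Lemma Noccur_cvg (p : mtree G) h : mroot_type p = kappa -> mark_type p = Some gamma ->
  kpath kappa p = h.+1 ->
  cvg_in_cond_prob P E
    (fun w => (Noccur kappa h p (T w))%:R / (m * (nb_type kappa (T w))%:R))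
    (fine (P' [set w | kfringe kappa h (That w) = (Fin p, false)])).
Proof.
move=> pk pg kp.
rewrite (kfringe_That_law Hxi Hgamma HTk HTs Hcrit Hmean HThat pk pg kp).
rewrite (_ : (fun w => _) = fun w =>
    (occurrences (val p).1 (T w))%:R / (m * (nb_type kappa (T w))%:R)).
  exact: (occurrences_cvg Hxi HT mE E0 Hs Hexp Hbig pk (m_gt0 Hmean)).
by apply/funext => w; rewrite (NoccurE _ pk kp).
Qed.

Hypothesis Hgam : cvg_in_cond_prob P E
  (fun w => (nb_type gamma (T w))%:R / (nb_type kappa (T w))%:R) m.
Variable L : tree G -> weak_probability R (mspace R kappa).
Hypothesis HL : uniform_marking gamma L.

Lemma cvg_in_cond_prob_whp (f : tree G -> R) (c e : R) : 0 < e ->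
  cvg_in_cond_prob P E (fun w => f (T w)) c ->
  whp P E (fun=> [set w | `|f (T w) - c| <= e]).
Proof.
move=> e0 fc; pose A (_ : nat) := [set w | e < `|f (T w) - c|].
have mA n : measurable (A n) by exact: (measurable_T HT [set t | e < `|f t - c|]).
have := (whpC mE E0 mA).2 (fc e e0).
apply: (whp_sub mE E0 (fun n => measurableC (mA n))).
  by move=> _; exact: (measurable_T HT [set t | `|f t - c| <= e]).
by apply: nearW => n w /negP; rewrite -leNgt.
Qed.

(** The proportion of occurrences among the vertices of type [gamma] is compared through the number
    of vertices of type [kappa]; this is where the assumed limit of the ratio of the two types
    enters. *)
Lemma cylinder_whp (p : mtree G) k (e : R) : 0 < e -> e <= 1 ->
  mroot_type p = kappa -> mark_type p = Some gamma -> kpath kappa p = k.+1 ->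
  whp P E (fun=> [set w |
    `|fine ((L (T w) : probability (borel_space R kappa) R) (cylinder p)) -
    fine (P' (That @^-1` cylinder p))| <= e]).
Proof.
move=> e0 e1 pk pg kp; have m0 := m_gt0 Hmean.
have thatE : That @^-1` cylinder p = [set w | kfringe kappa k (That w) = (Fin p, false)].
  by apply/seteqP; split=> w /(kfringeP _ pk kp).
have e40 : 0 < e / 4 by rewrite divr_gt0.
have me40 : 0 < m * e / 4 by rewrite divr_gt0// mulr_gt0.
pose c := fine (P' (That @^-1` cylinder p)).
have H1 := cvg_in_cond_prob_whp (f := fun t => (Noccur kappa k p t)%:R /
  (m * (nb_type kappa t)%:R)) e40 (Noccur_cvg pk pg kp).
have H2 := cvg_in_cond_prob_whp (f := fun t => (nb_type gamma t)%:R /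
  (nb_type kappa t)%:R) me40 Hgam.
have m1 (n : nat) := measurable_T HT [set t | `|(Noccur kappa k p t)%:R /
  (m * (nb_type kappa t)%:R) -
  fine (P' [set w | kfringe kappa k (That w) = (Fin p, false)])| <= e / 4].
have m2 (n : nat) := measurable_T HT [set t | `|(nb_type gamma t)%:R /
  (nb_type kappa t)%:R - m| <= m * e / 4].
have m3 (n : nat) := measurable_T HT [set t | `|fine ((L t :
  probability (borel_space R kappa) R) (cylinder p)) - c| <= e].
apply: (whp_sub mE E0 (fun n => measurableI _ _ (m1 n) (m2 n)) m3 _ (whpI mE E0 m1 m2 H1 H2)).
apply: nearW => n w [/= h1 h2].
have a01 : 0 <= fine (P' [set w | kfringe kappa k (That w) = (Fin p, false)]) <= 1.
  rewrite -thatE fine_ge0//= -lee_fin fine_probK ?probability_le1//;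
    exact: (measurable_That That (measurable_cylinder (R := R) (g0 := kappa) p)).
have [g0 H] := ratio_approx m0 e0 e1 (ler0n _ _) a01 h1 h2.
rewrite ltr0n in g0.
by rewrite /c thatE (uniform_marking_cylinder HL g0 pk pg kp) -(NoccurE _ pk kp).
Qed.

Lemma integrate_whp (f : bounded_continuous R (mspace R kappa)) (e : R) : 0 < e ->
  whp P E (fun=> [set w | `|integrate (L (T w)) f -
    integrate (distribution P' That : weak_probability R (mspace R kappa)) f| < e]).
Proof.
case: f => f [cf [M fM]] e0; rewrite /integrate /=.
have M0 : 0 <= M by apply: le_trans (fM (Fin (root_marking kappa))).
set nu : probability (borel_space R kappa) R := distribution P' That.
(* Chosen so that the final error 2 e' + 4 M e' is less than 4 (M + 1) e' = e. *)
pose e' := e / (4 * (M + 1)).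
have e'0 : 0 < e' by rewrite divr_gt0// mulr_gt0//; lra.
have e'E : e' * (4 * (M + 1)) = e by rewrite divfK// gt_eqF// mulr_gt0//; lra.
have [k [K [uK Kosc sK]]] := fringe_partition
  (That_kfringe_ae Hxi Hgamma HTk HTs Hcrit Hmean HThat) cf e'0.
(* The cap 1 is required by [cylinder_whp]; the successor avoids a division by zero when [K] is
   empty. *)
pose e1 := Num.min 1 (e' / (size K).+1%:R).
have e10 : 0 < e1 by rewrite lt_min ltr01 divr_gt0.
have e1K : (size K)%:R * e1 <= e'.
  apply: (@le_trans _ _ ((size K).+1%:R * e1)).
    by apply: ler_wpM2r; [exact: ltW|rewrite ler_nat].
  by rewrite mulrC -ler_pdivlMr// ge_min lexx orbT.
have mB p : measurable (cylinder p : set (borel_space R kappa)) by exact: measurable_cylinder.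
have mf := borel_measurable_continuous cf.
have dB p q x : p \in K -> q \in K -> cylinder p x -> cylinder q x -> p = q.
  by move=> /Kosc[pk _ kp _] /Kosc[qk _ kq _]; exact: (cylinder_disjoint pk kp qk kq).
pose a p := f (Fin p).
have fa p x : p \in K -> cylinder p x -> `|f x - a p| <= e'.
  by move=> /Kosc[_ _ _ pf] px; apply: pf => //; exact: fringe_self.
have approx (mu : probability (borel_space R kappa) R) :=
  integral_step_approx mu mB mf fM uK dB (fun p => fM (Fin p)) (ltW e'0) fa.
pose A (p : mtree G) (_ : nat) := [set w | `|fine ((L (T w) :
  probability (borel_space R kappa) R) (cylinder p)) -
  fine (P' (That @^-1` cylinder p))| <= e1].
have mA p n : measurable (A p n).
  exact: (measurable_T HT [set t | `|fine ((L t : probability (borel_space R kappa) R)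
    (cylinder p)) - fine (P' (That @^-1` cylinder p))| <= e1]).
have hA p : p \in K -> whp P E (A p).
  move=> /Kosc[pk pg kp _]; apply: (cylinder_whp e10 _ pk pg kp).
  by rewrite ge_min lexx.
have m2 (n : nat) := measurable_T HT [set t |
  `|Rintegral (L t : probability (borel_space R kappa) R) setT f - Rintegral nu setT f| < e].
apply: (whp_sub mE E0 _ m2 _ (whp_all mE E0 mA hA)).
  by move=> n; apply: measurable_forall_in.
apply: nearW => n w /= Aw.
apply: le_lt_trans (step_sums_close M0 (fun p => fM (Fin p)) Aw e1K sK
  (approx (L (T w))) (approx nu)) _.
by rewrite -e'E; nra.
Qed.

(** The sets of measures containing [L (T w)] with conditional probability tending to 1 form a
    filter, and convergence in probability means that this filter converges to the limit law. *)
Lemma limit_cvg : cvg_in_cond_prob_top P E (L \o T)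
  (distribution P' That : weak_probability R (mspace R kappa)).
Proof.
pose F : set_system (weak_probability R (mspace R kappa)) :=
  [set U | whp P E (fun=> (L \o T) @^-1` U)].
have mU U (n : nat) : measurable ((L \o T) @^-1` U) by exact: (measurable_T HT (L @^-1` U)).
have FF : Filter F.
  split.
  - exact: (whpT mE E0).
  - by move=> U V; exact: (whpI mE E0 (mU U) (mU V)).
  - by move=> U V UV; apply: (whp_sub mE E0 (mU U) (mU V)); apply: nearW => n w; exact: UV.
exact: (weak_probability_cvg FF integrate_whp).
Qed.
End WeakLimit.

Theorem theorem2 (R : realType) (G : countType)
    (d : measure_display) (W : measurableType d) (P : probability W R)
    (sigma : G -> W -> seq G) (alpha : W -> G)
    (xi : seq nat * G -> W -> seq G) (T : W -> tree G)
    (Hxi : offspring_family P sigma alpha xi)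
    (HT : galton_watson P alpha xi T)
    (Htypes : forall i, (0 < P [set w | nb_type i (T w) != 0%N])%E)
    (kappa gamma : G) (Hgamma : gamma != kappa)
    (Tk Ts : W -> tree G)
    (HTk : galton_watson P (cst kappa) xi Tk)
    (HTs : galton_watson P (cst kappa) (stopped kappa xi) Ts)
    (E : nat -> set W) (HE : forall n, measurable (E n))
    (HE0 : forall n, (0 < P (E n))%E)
    (Hcrit : mean_nb P kappa Ts = 2%:E)
    (s : nat -> R) (Hs : s @ \oo --> +oo)
    (Hexp : forall eps : R, 0 < eps ->
      (fun n => expR (- eps * s n)) =o_\oo (fun n => fine (P (E n))))
    (Hbig : (fun n => cond_prob P (E n)
        [set w | s n <= (nb_type kappa (T w))%:R]) @ \oo --> (1 : R))
    (Hmean : (0 < mean_nb P gamma Ts < +oo)%E)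
    (d' : measure_display) (W' : measurableType d') (P' : probability W' R)
    (That : {mfun W' >-> borel_space R kappa})
    (HThat : limit_tree kappa P P' gamma Tk Ts That) :
  (forall (p : mtree G) (h : nat),
    mroot_type p = kappa -> mark_type p = Some gamma -> kpath kappa p = h.+1 ->
    cvg_in_cond_prob P E
      (fun w => (Noccur kappa h p (T w))%:R
                / (fine (mean_nb P gamma Ts) * (nb_type kappa (T w))%:R))
      (fine (P' [set w | kfringe kappa h (That w) = (Fin p, false)]))) /\
  (cvg_in_cond_prob P E
     (fun w => (nb_type gamma (T w))%:R / (nb_type kappa (T w))%:R)
     (fine (mean_nb P gamma Ts)) ->
   forall L : tree G -> weak_probability R (mspace R kappa),
     uniform_marking gamma L ->
     cvg_in_cond_prob_top P E (L \o T)
       (distribution P' That : weak_probability R (mspace R kappa))).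
Proof.
split=> [p h pk pg kp|Hgam L HL].
  exact: (Noccur_cvg Hxi HT Hgamma HTk HTs HE HE0 Hcrit Hs Hexp Hbig Hmean HThat pk pg kp).
exact: (limit_cvg Hxi HT Hgamma HTk HTs HE HE0 Hcrit Hs Hexp Hbig Hmean HThat Hgam HL).
Qed.
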